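(* For any integers $n\ge1$ and $0\le m\le n$ and any $p\in\mathbb{C}$ with $1\le\Re(p)<2n-m$, \[ \sum_{i=0}^{2n-m}(-1)^{n-i}\binom{2n-m}{i}|n-i|^p = -2\sin(\pi p/2)\binom{2n-m}{n}\int_0^\infty\frac{x^p}{\sinh(\pi x)}\cdot\Re\Big(\frac{\Gamma(n-m+1)\Gamma(n+1)}{\Gamma(n-m+ix+1)\Gamma(n-ix+1)}\Big)\,dx. \]
   Context: For $x,y\in\mathbb{C}$, $x^y:=\exp(y\log x)$ where $\log$ is the principal branch with $-\pi<\Im(\log x)\le\pi$. $\Gamma$ is the Euler gamma function (analytically continued), and $\Re$ denotes real part. *)

(* Defs.v *)
From HB Require Import structures.
From mathcomp Require Import all_boot all_order all_algebra.
From mathcomp Require Import complex.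
From mathcomp Require Import all_classical all_reals all_analysis.

Set Implicit Arguments.
Unset Strict Implicit.
Unset Printing Implicit Defensive.

Import Order.TTheory GRing.Theory Num.Theory.
Import numFieldNormedType.Exports.

Local Open Scope classical_set_scope.
Local Open Scope ring_scope.
Local Open Scope complex_scope.

Section ComplexFunctions.
Context {R : realType}.
Implicit Types (x y z : R[i]) (t : R).

Definition cexp z : R[i] :=
  (expR (complex.Re z) * cos (complex.Im z))
    +i* (expR (complex.Re z) * sin (complex.Im z)).

(* Principal argument, in ]-pi, pi] for z != 0. *)
Definition carg z : R :=
  let a := acos (complex.Re z / ComplexField.Normc.normc z) in
  if 0 <= complex.Im z then a else - a.

Definition clog z : R[i] := ln (ComplexField.Normc.normc z) +i* carg z.

(* For x = 0, where log x is undefined: 0 ^ y = 0 for y != 0, and 0 ^ 0 = 1. *)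
Definition cpow x y : R[i] :=
  if x == 0 then (y == 0)%:R else cexp (y * clog x).

Definition csin z : R[i] := (cexp ('i%C * z) - cexp (- ('i%C * z))) / (2%:R * 'i%C).

Definition sinh t : R := (expR t - expR (- t)) / 2%:R.

Definition cintegrable (D : set R) (f : R -> R[i]) : Prop :=
  (@lebesgue_measure R).-integrable D (fun t => (complex.Re (f t))%:E) /\
  (@lebesgue_measure R).-integrable D (fun t => (complex.Im (f t))%:E).

Definition cintegral (D : set R) (f : R -> R[i]) : R[i] :=
  (\int[@lebesgue_measure R]_(t in D) complex.Re (f t))
    +i* (\int[@lebesgue_measure R]_(t in D) complex.Im (f t)).

(* Euler's integral; meaningful for 0 < Re z. *)
Definition gamma_integral z : R[i] :=
  cintegral `]0, +oo[ (fun t => cpow t%:C (z - 1) * (expR (- t))%:C).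

(* A number k of unit translations with 0 < Re (z + k). *)
Definition gamma_shift z : nat :=
  if 0 < complex.Re z then 0%N else (Num.truncn (- complex.Re z)).+1.

(* Analytic continuation of Euler's integral through the functional equation
   Gamma (z + k) = z (z + 1) ... (z + k - 1) Gamma z; the value at the poles
   0, -1, -2, ... is 0. *)
Definition Gamma z : R[i] :=
  gamma_integral (z + (gamma_shift z)%:R)
    / \prod_(j < gamma_shift z) (z + j%:R).

End ComplexFunctions.

(* Main.v *)
(** By the reflection formula for Gamma, with [N = 2n - m] and [y = ix], the integrand
    is [x ^ p / (pi x)] times the real part of a rational function of [x] whose partial
    fraction expansion is [1 / 'C(N, n)] times
    [\sum_i (-1) ^ (n - i) 'C(N, i) y / (y - (n - i))], so that only the Mellin
    transforms of [x ^ 2 / (x ^ 2 + (n - i) ^ 2)] are needed.  These diverge one by one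
    when [Re p] is large, but the [N]-th finite difference kills even powers of [n - i]
    below [N], which shifts [p / 2] by an integer [j] into the strip [0 <= Re w < 1]; an
    integration by parts then turns every term into the beta integral
    [K w = \int_0^oo u ^ w / (1 + u) ^ 2 du = Gamma (1 + w) Gamma (1 - w)], including on
    the line [Re w = 0].

    All integrals are moved to the real line by [u = exp t].  For [K w sin (pi w) = pi w],
    rotating the line of integration to [Im = pi / 2] and [Im = - pi / 2] relates [K w] to
    [K ((w + 1) / 2)] and [K ((w - 1) / 2)] in such a way that [K w sin (pi w) / w] is
    invariant under [w |-> (w - 1) / 4]; iterating converges to the fixed point [- 1 / 3],
    and the constant is found at [w = 1 / 2]. *)

Require Import Defs.
From HB Require Import structures.
From mathcomp Require Import all_boot all_order all_algebra.
From mathcomp Require Import complex.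
From mathcomp Require Import all_classical all_reals all_analysis.
From mathcomp Require Import measurable_realfun ring lra.

Set Implicit Arguments.
Unset Strict Implicit.
Unset Printing Implicit Defensive.

Import Order.TTheory GRing.Theory Num.Theory.
Import numFieldNormedType.Exports.

Local Open Scope classical_set_scope.
Local Open Scope ring_scope.
Local Open Scope complex_scope.

(** Holomorphy enters only through derivatives along straight lines, and every integration by parts
    is an instance of one fact: the derivative of a function that decays exponentially at both ends
    of the line has integral 0. The kernel [1 / (1 + u) ^ 2] is preferred to [1 / (1 + u)] because
    its strip [-1 < Re w < 1] is stable under both [w |-> (w + 1) / 2] and [w |-> (w - 1) / 2]. Each
    of these maps by itself preserves [K w sin (pi w) / w], but its fixed point, 1 or -1, lies on
    the boundary of the strip, where [K] diverges. Their composite [(w - 1) / 4] has its fixed point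
    inside, so that the limit is a matter of continuity. One kind of exponent escapes division by
    [w]: if [p] is an even integer, then [w = 0]. There the sine vanishes, and so does the sum,
    being a finite difference of a polynomial of degree below [N]. *)

Local Notation Re := complex.Re.
Local Notation Im := complex.Im.
Local Notation normc := ComplexField.Normc.normc.

(** * Complex-valued functions of a real variable *)

Section ComplexCalculus.
Context {R : realType}.
Implicit Types (x y z w : R[i]) (t s : R) (F G : R -> R[i]).
Local Notation mu := (@lebesgue_measure R).

Lemma complexP z w : Re z = Re w -> Im z = Im w -> z = w.
Proof. by case: z w => [a b] [c d] /= -> ->. Qed.

Lemma ReD z w : Re (z + w) = Re z + Re w. Proof. by case: z w => [a b] []. Qed.
Lemma ImD z w : Im (z + w) = Im z + Im w. Proof. by case: z w => [a b] []. Qed.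
Lemma ReN z : Re (- z) = - Re z. Proof. by case: z. Qed.
Lemma ImN z : Im (- z) = - Im z. Proof. by case: z. Qed.
Lemma ReM z w : Re (z * w) = Re z * Re w - Im z * Im w.
Proof. by case: z w => [a b] []. Qed.
Lemma ImM z w : Im (z * w) = Re z * Im w + Im z * Re w.
Proof. by case: z w => [a b] []. Qed.
Lemma ReV z : Re z^-1 = Re z / (Re z ^+ 2 + Im z ^+ 2). Proof. by case: z. Qed.
Lemma ImV z : Im z^-1 = - (Im z / (Re z ^+ 2 + Im z ^+ 2)).
Proof. by case: z. Qed.
Lemma Re_nat (n : nat) : Re (n%:R : R[i]) = n%:R.
Proof. by elim: n => //= n ih; rewrite !mulrS ReD ih. Qed.
Lemma Im_nat (n : nat) : Im (n%:R : R[i]) = 0.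
Proof. by elim: n => //= n ih; rewrite !mulrS ImD ih addr0. Qed.
Lemma natc (n : nat) : (n%:R : R)%:C = n%:R :> R[i].
Proof. by rewrite rmorph_nat. Qed.

Definition ReImE := (ReD, ImD, ReN, ImN, ReM, ImM, Re_nat, Im_nat).

Lemma Re_sum (I : Type) (r : seq I) (P : pred I) (h : I -> R[i]) :
  Re (\sum_(i <- r | P i) h i) = \sum_(i <- r | P i) Re (h i).
Proof. by apply: (big_morph _ ReD). Qed.

Lemma normcE z : normc z = Num.sqrt (Re z ^+ 2 + Im z ^+ 2).
Proof. by case: z. Qed.
Lemma normc_sqr z : normc z ^+ 2 = Re z ^+ 2 + Im z ^+ 2.
Proof. by rewrite normcE sqr_sqrtr // addr_ge0 // sqr_ge0. Qed.
Lemma normc_ge0 z : 0 <= normc z.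
Proof. by rewrite normcE sqrtr_ge0. Qed.
Lemma Re_le_normc z : `|Re z| <= normc z.
Proof.
by rewrite normcE -sqrtr_sqr ler_wsqrtr // lerDl sqr_ge0.
Qed.
Lemma Im_le_normc z : `|Im z| <= normc z.
Proof.
by rewrite normcE -sqrtr_sqr ler_wsqrtr // lerDr sqr_ge0.
Qed.
Lemma normc_real t : normc t%:C = `|t|.
Proof. by rewrite normcE /= expr0n addr0 sqrtr_sqr. Qed.
Lemma normcX z n : normc (z ^+ n) = normc z ^+ n.
Proof.
elim: n => [|n ih]; first by rewrite !expr0 ComplexField.Normc.normc1.
by rewrite !exprS ComplexField.Normc.normcM ih.
Qed.
Lemma normc0 : normc (0 : R[i]) = 0.
Proof. by rewrite normcE /= expr0n addr0 sqrtr0. Qed.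
Lemma normc_eq0 z : (normc z == 0) = (z == 0).
Proof.
apply/eqP/eqP => [/ComplexField.Normc.eq0_normc //|->].
exact: normc0.
Qed.
Lemma le_normc_sum (I : Type) (r : seq I) (P : pred I) (h : I -> R[i]) :
  normc (\sum_(i <- r | P i) h i) <= \sum_(i <- r | P i) normc (h i).
Proof.
apply: (big_ind2 (fun a b => normc a <= b)) => //; first by rewrite normc0.
by move=> a b c d hab hcd; rewrite (le_trans (le_normcD _ _)) // lerD.
Qed.

Lemma cexp0 : cexp (0 : R[i]) = 1.
Proof. by apply: complexP; rewrite /= expR0 ?cos0 ?sin0 ?mulr1 ?mulr0. Qed.
Lemma cexpD z w : cexp (z + w) = cexp z * cexp w.
Proof.
apply: complexP; rewrite ?ReM ?ImM /= ReD ImD expRD ?cosD ?sinD; ring.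
Qed.
Lemma normc_cexp z : normc (cexp z) = expR (Re z).
Proof.
rewrite normcE /= !exprMn -mulrDr cos2Dsin2 mulr1 sqrtr_sqr ger0_norm ?expR_ge0 //.
Qed.
Lemma cexp_neq0 z : cexp z != 0.
Proof. by rewrite -normc_eq0 normc_cexp expR_eq0. Qed.
Lemma cexpN z : cexp (- z) = (cexp z)^-1.
Proof.
apply: (mulIf (cexp_neq0 z)); rewrite mulVf ?cexp_neq0 //.
by rewrite -cexpD addNr cexp0.
Qed.
Lemma cexp_real t : cexp t%:C = (expR t)%:C.
Proof. by apply: complexP; rewrite /= ?cos0 ?sin0 ?mulr1 ?mulr0. Qed.
Lemma cexp_natl n z : cexp (n%:R * z) = cexp z ^+ n.
Proof.
elim: n => [|n ih]; first by rewrite mul0r cexp0 expr0.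
by rewrite exprS -ih -cexpD mulrS mulrDl mul1r.
Qed.

(** * Continuity and derivatives by components *)

Definition ccontinuous F :=
  continuous (fun t => Re (F t)) /\ continuous (fun t => Im (F t)).

Definition is_cderive F t z :=
  is_derive t 1 (fun s => Re (F s)) (Re z) /\
  is_derive t 1 (fun s => Im (F s)) (Im z).

Lemma eq_ccontinuous F G : F =1 G -> ccontinuous F -> ccontinuous G.
Proof. by move=> /funext ->. Qed.
Lemma ccontinuous_cst z : ccontinuous (fun=> z).
Proof. by split => t; exact: cst_continuous. Qed.
Lemma ccontinuous_real (h : R -> R) : continuous h -> ccontinuous (fun t => (h t)%:C).
Proof. by move=> ch; split => t //=; exact: cst_continuous. Qed.
Lemma ccontinuousD F G : ccontinuous F -> ccontinuous G ->
  ccontinuous (fun t => F t + G t).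
Proof.
move=> [fr fi] [gr gi]; split => t.
- under eq_fun do rewrite ReD; by apply: continuousD; [exact: fr|exact: gr].
- under eq_fun do rewrite ImD; by apply: continuousD; [exact: fi|exact: gi].
Qed.
Lemma ccontinuousN F : ccontinuous F -> ccontinuous (fun t => - F t).
Proof.
move=> [fr fi]; split => t.
- under eq_fun do rewrite ReN; by apply: continuousN; exact: fr.
- under eq_fun do rewrite ImN; by apply: continuousN; exact: fi.
Qed.
Lemma ccontinuousB F G : ccontinuous F -> ccontinuous G ->
  ccontinuous (fun t => F t - G t).
Proof. by move=> cF cG; apply: ccontinuousD => //; exact: ccontinuousN. Qed.
Lemma ccontinuousM F G : ccontinuous F -> ccontinuous G ->
  ccontinuous (fun t => F t * G t).
Proof.
move=> [fr fi] [gr gi]; split => t.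
- under eq_fun do rewrite ReM.
  apply: cvgB; apply: cvgM;
    [exact: fr|exact: gr|exact: fi|exact: gi].
- under eq_fun do rewrite ImM.
  apply: cvgD; apply: cvgM;
    [exact: fr|exact: gi|exact: fi|exact: gr].
Qed.
Lemma ccontinuousX F n : ccontinuous F -> ccontinuous (fun t => F t ^+ n).
Proof.
move=> cF; elim: n => [|n ih].
  by under eq_fun do rewrite expr0; exact: ccontinuous_cst.
by under eq_fun do rewrite exprS; exact: ccontinuousM.
Qed.
Lemma sqrDsqr_neq0 z : z != 0 -> Re z ^+ 2 + Im z ^+ 2 != 0.
Proof. by rewrite -normc_sqr sqrf_eq0 normc_eq0. Qed.
Lemma ccontinuousV F : (forall t, F t != 0) -> ccontinuous F ->
  ccontinuous (fun t => (F t)^-1).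
Proof.
move=> F0 [fr fi].
have cn t : {for t, continuous (fun s => (Re (F s) ^+ 2 + Im (F s) ^+ 2)^-1)}.
  apply: cvgV; first exact/sqrDsqr_neq0.
  by apply: cvgD; apply: cvgM; first [exact: fr|exact: fi].
split => t.
- under eq_fun do rewrite ReV; by apply: cvgM; [exact: fr|exact: cn].
- under eq_fun do rewrite ImV.
  by apply: cvgN; apply: cvgM; [exact: fi|exact: cn].
Qed.
Lemma ccontinuous_sum (I : Type) (r : seq I) (P : pred I) (h : I -> R -> R[i]) :
  (forall i, P i -> ccontinuous (h i)) ->
  ccontinuous (fun t => \sum_(i <- r | P i) h i t).
Proof.
move=> ch; elim: r => [|i r ih].
  by under eq_fun do rewrite big_nil; exact: ccontinuous_cst.
under eq_fun do rewrite big_cons; have [Pi|//] := boolP (P i).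
by apply: ccontinuousD => //; exact: ch.
Qed.

(** The rules for one real variable, in a form that unifies with explicit abstractions and writes
    derivatives with products instead of scalings. *)
Lemma is_derive1_eq (f : R -> R) t (a b : R) :
  is_derive t 1 f a -> a = b -> is_derive t 1 f b.
Proof. by move=> ? <-. Qed.
Lemma is_derive1D (f g : R -> R) t (a b : R) : is_derive t 1 f a -> is_derive t 1 g b ->
  is_derive t 1 (fun s => f s + g s) (a + b).
Proof. exact: is_deriveD. Qed.
Lemma is_derive1B (f g : R -> R) t (a b : R) : is_derive t 1 f a -> is_derive t 1 g b ->
  is_derive t 1 (fun s => f s - g s) (a - b).
Proof. exact: is_deriveB. Qed.
Lemma is_derive1M (f g : R -> R) t (a b : R) : is_derive t 1 f a -> is_derive t 1 g b ->
  is_derive t 1 (fun s => f s * g s) (a * g t + f t * b).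
Proof.
move=> df dg; apply: (is_derive1_eq (is_deriveM df dg)).
by rewrite /GRing.scale /=; ring.
Qed.
Lemma is_derive1V (f : R -> R) t (a : R) : f t != 0 -> is_derive t 1 f a ->
  is_derive t 1 (fun s => (f s)^-1) (- a / f t ^+ 2).
Proof.
move=> f0 df; apply: (is_derive1_eq (is_deriveV f0 df)).
by rewrite /GRing.scale /=; ring.
Qed.
Lemma is_derive1_affine a b t : is_derive t 1 (fun s : R => a + b * s) b.
Proof.
by apply: is_derive_eq; rewrite /GRing.scale /=; ring.
Qed.

Lemma is_cderive_ext F G t z : F =1 G -> is_cderive F t z -> is_cderive G t z.
Proof. by move=> /funext ->. Qed.
Lemma is_cderive_eq F t z w : is_cderive F t z -> z = w -> is_cderive F t w.
Proof. by move=> ? <-. Qed.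
Lemma is_cderive_cst z t : is_cderive (fun=> z) t 0.
Proof. by split; exact: is_derive_cst. Qed.
Lemma is_cderive_real (h : R -> R) t d :
  is_derive t 1 h d -> is_cderive (fun s => (h s)%:C) t d%:C.
Proof. by move=> dh; split => //=; exact: is_derive_cst. Qed.
Lemma is_cderiveD F G t z w : is_cderive F t z -> is_cderive G t w ->
  is_cderive (fun s => F s + G s) t (z + w).
Proof.
move=> [fr fi] [gr gi]; split.
- by under eq_fun do rewrite ReD; rewrite ReD; exact: is_deriveD.
- by under eq_fun do rewrite ImD; rewrite ImD; exact: is_deriveD.
Qed.
Lemma is_cderiveM F G t z w : is_cderive F t z -> is_cderive G t w ->
  is_cderive (fun s => F s * G s) t (z * G t + F t * w).
Proof.
move=> [fr fi] [gr gi]; split.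
- under eq_fun do rewrite ReM.
  apply: (is_derive1_eq (is_derive1B (is_derive1M fr gr) (is_derive1M fi gi))).
  by rewrite !ReImE /=; ring.
- under eq_fun do rewrite ImM.
  apply: (is_derive1_eq (is_derive1D (is_derive1M fr gi) (is_derive1M fi gr))).
  by rewrite !ReImE /=; ring.
Qed.
Lemma is_cderiveZ F t z w : is_cderive F t z -> is_cderive (fun s => w * F s) t (w * z).
Proof.
move=> dF; apply: is_cderive_eq; first exact: is_cderiveM (is_cderive_cst w t) dF.
by rewrite mul0r add0r.
Qed.
Lemma is_cderiveV F t z : F t != 0 -> is_cderive F t z ->
  is_cderive (fun s => (F s)^-1) t (- z / F t ^+ 2).
Proof.
move=> F0 [fr fi]; have n0 := sqrDsqr_neq0 F0.
pose q s := (Re (F s) ^+ 2 + Im (F s) ^+ 2)^-1.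
have dq : is_derive t 1 q
    (- (2 * Re (F t) * Re z + 2 * Im (F t) * Im z) * q t ^+ 2).
  apply: (is_derive1_eq (@is_derive1V (fun s => Re (F s) * Re (F s) + Im (F s) * Im (F s))
      _ _ n0 (is_derive1D (is_derive1M fr fr) (is_derive1M fi fi)))).
  by rewrite /q exprVn; congr (_ / _); ring.
have e : - z / F t ^+ 2 = - (z * (F t)^-1 * (F t)^-1).
  by rewrite expr2 invfM mulNr mulrA.
rewrite e; split.
- under eq_fun do rewrite ReV.
  apply: (is_derive1_eq (is_derive1M fr dq)).
  rewrite ReN !(ReM,ImM) ReV ImV -/(q t).
  have: (Re (F t) ^+ 2 + Im (F t) ^+ 2) * q t = 1 by rewrite mulfV.
  move: (q t) (Re (F t)) (Im (F t)) (Re z) (Im z) => k a b c d h.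
  (* The sides differ in their degree in [k], the inverse of [a ^+ 2 + b ^+ 2]; inserting this
     factor 1 makes the identity polynomial. *)
  have -> : c * k = c * k * ((a ^+ 2 + b ^+ 2) * k) by rewrite h mulr1.
  ring.
- under eq_fun do rewrite ImV.
  apply: (is_derive1_eq (is_deriveN (is_derive1M fi dq))).
  rewrite ImN !(ReM,ImM) ReV ImV -/(q t).
  have: (Re (F t) ^+ 2 + Im (F t) ^+ 2) * q t = 1 by rewrite mulfV.
  move: (q t) (Re (F t)) (Im (F t)) (Re z) (Im z) => k a b c d h.
  have -> : d * k = d * k * ((a ^+ 2 + b ^+ 2) * k) by rewrite h mulr1.
  ring.
Qed.
(** The complex direction [w] is what later gives the derivatives along and across the strip from a
    single statement. *)
Lemma is_cderive_cexp z w t :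
  is_cderive (fun s => cexp (z + w * s%:C)) t (w * cexp (z + w * t%:C)).
Proof.
have reE s : Re (z + w * s%:C) = Re z + Re w * s by rewrite !ReImE /=; ring.
have imE s : Im (z + w * s%:C) = Im z + Im w * s by rewrite !ReImE /=; ring.
have de : is_derive t 1 (fun s => expR (Re z + Re w * s))
    (Re w * expR (Re z + Re w * t)).
  by apply: is_derive_eq; rewrite /GRing.scale /=; ring.
split.
- under eq_fun do rewrite /= reE imE.
  apply: is_derive_eq.
  by rewrite ReM /= reE imE /GRing.scale /=; ring.
- under eq_fun do rewrite /= reE imE.
  apply: is_derive_eq.
  by rewrite ImM /= reE imE /GRing.scale /=; ring.
Qed.

Lemma is_cderive_continuous F (F' : R -> R[i]) :
  (forall t, is_cderive F t (F' t)) -> ccontinuous F.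
Proof.
move=> dF; split => t; have [dr di] := dF t;
  exact/differentiable_continuous/derivable1_diffP.
Qed.
Lemma ccontinuous_cexp z w : ccontinuous (fun t => cexp (z + w * t%:C)).
Proof. by apply: is_cderive_continuous => t; exact: is_cderive_cexp. Qed.

End ComplexCalculus.

(** * Integration over the real line *)

Section Integration.
Context {R : realType}.
Implicit Types (z w : R[i]) (t s : R) (f g : R -> R) (F G : R -> R[i]).
Local Notation mu := (@lebesgue_measure R).

(** * The fundamental theorem of calculus on the whole line *)

Let I (k : nat) : set R := `[- k.+1%:R, k.+1%:R].

Let subI k l : (k <= l)%N -> I k `<=` I l.
Proof.
move=> kl t /=; rewrite /I /= !in_itv /= => /andP[h1 h2].
have kl' : k.+1%:R <= l.+1%:R :> R by rewrite ler_nat.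
by rewrite (le_trans _ h1) ?lerN2 //= (le_trans h2).
Qed.

Let nearI t : \forall k \near \oo, I k t.
Proof.
have [N hN] : exists N : nat, `|t| < N%:R.
  by exists (Num.truncn `|t|).+1; rewrite truncnS_gt.
exists N => //= k /= Nk; rewrite /I /= in_itv /= -ler_norml.
by rewrite (le_trans (ltW hN)) // ler_nat (leq_trans Nk).
Qed.

Let bigcupI : \bigcup_k I k = setT.
Proof.
apply/seteqP; split => // t _; have [k _ h] := nearI t.
by exists k => //; apply: h => /=.
Qed.

(** Dominated convergence for the restrictions of [f] to the segments, with the absolute value of
    [f] as majorant. *)
Let cvg_Rintegral_itv f : mu.-integrable setT (EFin \o f) ->
  (\int[mu]_(t in I k) f t) @[k --> \oo] --> \int[mu]_t f t.
Proof.
move=> intf; apply: fine_cvg.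
rewrite /Rintegral fineK ?integrable_fin_num //.
have -> : (fun k => \int[mu]_(t in I k) (f t)%:E)%E =
    (fun k => \int[mu]_t ((EFin \o f) \_ (I k)) t)%E.
  by apply/funext => k; rewrite integral_mkcond.
apply: (@dominated_cvg _ _ _ mu _ measurableT _ _ (fun t => `|(f t)%:E|)%E) => //.
- move=> k; apply/measurable_restrict => //; first exact: measurable_itv.
  by apply: (measurable_funS measurableT) => //; exact: (measurable_int mu intf).
- move=> t _; apply: cvg_near_cst.
  by apply: filterS (nearI t) => k kt; rewrite patchE mem_set.
- exact: integrable_abse.
- by move=> k t _; rewrite patchE; case: ifPn => // _; rewrite abse0 abse_ge0.
Qed.

Lemma Rintegral_FTC f (F : R -> R) (l l' : R) :
  (forall t, is_derive t 1 F (f t)) -> continuous f ->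
  mu.-integrable setT (EFin \o f) ->
  F t @[t --> +oo] --> l -> F t @[t --> -oo] --> l' ->
  \int[mu]_t f t = l - l'.
Proof.
move=> dF cf intf Fl Fl'.
have cF t : F s @[s --> t] --> F t.
  exact/differentiable_continuous/derivable1_diffP.
have ftc k : \int[mu]_(t in I k) f t = F k.+1%:R - F (- k.+1%:R).
  rewrite /Rintegral (@continuous_FTC2 _ f F) //.
  - by rewrite (@lt_trans _ _ 0) ?oppr_lt0 ?ltr0n.
  - exact: continuous_subspaceT.
  - split => [t _||]; first exact: ex_derive.
    + apply: cvg_at_right_filter; exact: cF.
    + apply: cvg_at_left_filter; exact: cF.
  - by move=> t _; rewrite derive1E; exact: derive_val.
apply: (@cvg_unique _ (@Rhausdorff R) _ _ _ _ (cvg_Rintegral_itv intf)).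
have e : (fun k => \int[mu]_(t in I k) f t) = (fun k => F k.+1%:R - F (- k.+1%:R)).
  exact/funext.
rewrite /= e.
have ny : (k.+1%:R : R) @[k --> \oo] --> +oo.
  by rewrite (cvg_shiftS (fun k : nat => k%:R : R)); exact: cvgr_idn.
apply: cvgB; first exact: (cvg_comp _ _ ny Fl).
have nNy : (- k.+1%:R : R) @[k --> \oo] --> -oo by apply/cvgNrNy.
exact: (cvg_comp _ _ nNy Fl').
Qed.

(** * Change of variables on unbounded domains *)

Section substitution.
Variables (phi phi' : R -> R) (D : set R).
Hypothesis dphi : forall t, is_derive t 1 phi (phi' t).
Hypothesis cphi' : continuous phi'.
Hypothesis phi'_gt0 : forall t, 0 < phi' t.
Hypothesis phiD : forall x, D x <-> exists t, x = phi t.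
Hypothesis mD : measurable D.

Let cphi t : phi s @[s --> t] --> phi t.
Proof. exact/differentiable_continuous/derivable1_diffP. Qed.

Let incphi : {homo phi : x y / x < y}.
Proof.
move=> a b ab.
have cab : {within `[a, b], continuous phi}.
  by apply: continuous_subspaceT => t; exact: cphi.
have [c _ h] := MVT ab (fun t _ => dphi t) cab.
by rewrite -subr_gt0 h mulr_gt0 // subr_gt0.
Qed.

Let J k : set R := `[phi (- k.+1%:R), phi k.+1%:R].

Let JD k : J k `<=` D.
Proof.
move=> x; rewrite /J /= in_itv /= => /andP[h1 h2]; apply/phiD.
have [|||t _ <-] := @IVT R phi (- k.+1%:R) k.+1%:R x.
- by rewrite (@le_trans _ _ 0) ?oppr_le0 ?ler0n.
- by apply: continuous_subspaceT => t; exact: cphi.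
- by rewrite ge_min le_max h1 h2 orbT.
- by exists t.
Qed.

Let bigcupJ : \bigcup_k J k = D.
Proof.
apply/seteqP; split => [x [k _ /JD //]|x /phiD [t ->]].
have [k _ /(_ k (leqnn _)) /=] := nearI t; rewrite /I /= in_itv /= => /andP[h1 h2].
exists k => //; rewrite /J /= in_itv /=.
by rewrite !(le_mono incphi) h1 h2.
Qed.

(** By monotone convergence both sides are limits over the exhausting segments [J k] and [I k], on
    which the substitution rule for a compact interval applies. *)
Lemma ge0_integral_substitution f : (forall x, D x -> {for x, continuous f}) ->
  (forall x, D x -> 0 <= f x) ->
  (\int[mu]_(x in D) (f x)%:E = \int[mu]_t (f (phi t) * phi' t)%:E)%E.
Proof.
move=> cf f0.
have Dphi t : D (phi t) by apply/phiD; exists t.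
have mf : measurable_fun D (EFin \o f).
  rewrite -bigcupJ; apply/measurable_fun_bigcup; first by move=> k; exact: measurable_itv.
  move=> k; apply/measurable_EFinP.
  apply: subspace_continuous_measurable_fun; first exact: measurable_itv.
  by apply: continuous_in_subspaceT => x /set_mem /JD /cf.
have cfphi : continuous (fun t => f (phi t) * phi' t).
  move=> t; apply: cvgM; last exact: cphi'.
  apply: continuous_comp; first exact: cphi.
  exact/cf.
have mfphi : measurable_fun setT (fun t => (f (phi t) * phi' t)%:E).
  by apply/measurable_EFinP; exact: continuous_measurable_fun.
have c1 : (\int[mu]_(x in J k) (f x)%:E)%E @[k --> \oo] --> (\int[mu]_(x in D) (f x)%:E)%E.
  rewrite -bigcupJ; apply: ge0_nondecreasing_set_cvg_integral.
  - move=> k l kl; rewrite subsetEset => x; rewrite /J /= !in_itv /= => /andP[h1 h2].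
    have kl' : k.+1%:R <= l.+1%:R :> R by rewrite ler_nat.
    rewrite (le_trans _ h1) ?(le_mono incphi) ?lerN2 //=.
    by rewrite (le_trans h2) // (le_mono incphi).
  - by move=> k; exact: measurable_itv.
  - by move=> k; apply: (measurable_funS mD) mf; exact: JD.
  - by move=> k x /JD Dx; rewrite lee_fin f0.
have c2 : (\int[mu]_(t in I k) (f (phi t) * phi' t)%:E)%E @[k --> \oo] -->
    (\int[mu]_t (f (phi t) * phi' t)%:E)%E.
  rewrite -bigcupI; apply: ge0_nondecreasing_set_cvg_integral.
  - by move=> k l kl; rewrite subsetEset; exact: subI.
  - by move=> k; exact: measurable_itv.
  - by move=> k; apply: (measurable_funS measurableT) mfphi.
  - by move=> k t _; rewrite lee_fin mulr_ge0 ?f0 ?ltW.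
apply: (@cvg_unique _ (@ereal_hausdorff R) _ _ _ _ c1).
apply: cvg_trans c2; apply: near_eq_cvg; near=> k.
have phi'E : derive1 phi = phi' by apply/funext => t; rewrite derive1E; exact: derive_val.
have := @integration_by_substitution_increasing R phi f (- k.+1%:R) k.+1%:R.
rewrite phi'E -/(J k) -/(I k) => -> //.
- by rewrite (@le_trans _ _ 0) ?oppr_le0 ?ler0n.
- by move=> a b _ _; exact: incphi.
- by apply/cvg_ex; exists (phi' (- k.+1%:R)); apply: cvg_at_right_filter; exact: cphi'.
- by apply/cvg_ex; exists (phi' k.+1%:R); apply: cvg_at_left_filter; exact: cphi'.
- split => [t _||]; first exact: ex_derive.
  + apply: cvg_at_right_filter; exact: cphi.
  + apply: cvg_at_left_filter; exact: cphi.
- by apply: continuous_in_subspaceT => x /set_mem /JD /cf.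
Unshelve. all: by end_near. Qed.

(** Integrability is carried from the line to [D], because the exponential decay is visible only
    after the substitution. The nonnegative case is applied to the absolute value and to the
    positive and negative parts of [f]. *)
Lemma integral_substitution f : (forall x, D x -> {for x, continuous f}) ->
  mu.-integrable setT (fun t => (f (phi t) * phi' t)%:E) ->
  mu.-integrable D (EFin \o f) /\
  \int[mu]_(x in D) f x = \int[mu]_t (f (phi t) * phi' t).
Proof.
move=> cf intf.
have Dphi t : D (phi t) by apply/phiD; exists t.
have mf : measurable_fun D (EFin \o f).
  rewrite -bigcupJ; apply/measurable_fun_bigcup; first by move=> k; exact: measurable_itv.
  move=> k; apply/measurable_EFinP.
  apply: subspace_continuous_measurable_fun; first exact: measurable_itv.
  by apply: continuous_in_subspaceT => x /set_mem /JD /cf.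
have sub g : (forall x, D x -> {for x, continuous g}) -> (forall x, 0 <= g x) ->
  (\int[mu]_(x in D) (g x)%:E = \int[mu]_t (g (phi t) * phi' t)%:E)%E.
  by move=> cg g0; apply: ge0_integral_substitution.
split.
  apply/integrableP; split => //.
  rewrite (_ : (\int[mu]_(x in D) _)%E = \int[mu]_(x in D) (`|f x|)%:E)%E //.
  rewrite sub //; last first.
    by move=> x /cf cfx; apply: cvg_norm.
  case/integrableP: intf => _; apply: le_lt_trans.
  rewrite le_eqVlt; apply/orP; left; apply/eqP/eq_integral => t _.
  by rewrite /= normrM (gtr0_norm (phi'_gt0 t)).
rewrite /Rintegral; congr fine.
rewrite integralE [RHS]integralE; congr (_ - _)%E.
- rewrite (_ : (\int[mu]_(x in D) _)%E = \int[mu]_(x in D) (Num.max (f x) 0)%:E)%E; last first.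
    by apply: eq_integral => x _; rewrite funeposE /= EFin_max.
  rewrite sub.
  + apply: eq_integral => t _; rewrite funeposE /= -EFin_max; congr EFin.
    by rewrite maxr_pMl ?mul0r // ltW.
  + by move=> x /cf cfx; apply: continuous_max => //; exact: cst_continuous.
  + by move=> x; rewrite le_max lexx orbT.
- rewrite (_ : (\int[mu]_(x in D) _)%E = \int[mu]_(x in D) (Num.max (- f x) 0)%:E)%E; last first.
    by apply: eq_integral => x _; rewrite funenegE /= EFin_max.
  rewrite sub.
  + apply: eq_integral => t _; rewrite funenegE /= -EFin_max; congr EFin.
    by rewrite -mulNr maxr_pMl ?mul0r // ltW.
  + move=> x /cf cfx; apply: continuous_max; last exact: cst_continuous.
    by apply: cvgN.
  + by move=> x; rewrite le_max lexx orbT.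
Qed.

End substitution.

Lemma integral_expR f : (forall x, 0 < x -> {for x, continuous f}) ->
  mu.-integrable setT (fun t => (f (expR t) * expR t)%:E) ->
  mu.-integrable `]0, +oo[ (EFin \o f) /\
  \int[mu]_(x in `]0, +oo[) f x = \int[mu]_t (f (expR t) * expR t).
Proof.
move=> cf; apply: (@integral_substitution expR expR) => //.
- exact: continuous_expR.
- exact: expR_gt0.
- move=> x /=; rewrite in_itv /= andbT; split => [x0|[t ->]]; last exact: expR_gt0.
  by exists (ln x); rewrite lnK.
- by move=> x /=; rewrite in_itv /= andbT; exact: cf.
Qed.

Lemma Rintegral_affine f (a b : R) : 0 < a -> continuous f ->
  mu.-integrable setT (fun t => (f (b + a * t) * a)%:E) ->
  mu.-integrable setT (EFin \o f) /\
  \int[mu]_t f t = \int[mu]_t (f (b + a * t) * a).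
Proof.
move=> a0 cf; apply: (@integral_substitution (fun t => b + a * t) (fun=> a)) => //.
- by move=> t; exact: is_derive1_affine.
- by move=> t; exact: cst_continuous.
- move=> x; split => // _; exists ((x - b) / a).
  by rewrite mulrC divfK ?gt_eqF // addrC subrK.
- by move=> x _; exact: cf.
Qed.

Lemma integrable_expR_abs (c : R) : 0 < c ->
  mu.-integrable setT (fun t => (expR (- (c * `|t|)))%:E).
Proof.
move=> c0.
have cexp : continuous (fun t => expR (- (c * `|t|))).
  move=> t; apply: continuous_comp; last exact: continuous_expR.
  apply: cvgN; apply: cvgM; first exact: cvg_cst.
  exact: norm_continuous.
apply/integrableP; split.
  by apply/measurable_EFinP; exact: continuous_measurable_fun.
under eq_integral do rewrite /= ger0_norm ?expR_ge0 //.
rewrite (@ge0_symfun_integralT _ (fun t => expR (- (c * `|t|)))) //; first last.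
  by move=> t /=; rewrite normrN.
rewrite -set_itvcy.
rewrite [X in (_ * X)%E](_ : _ = \int[mu]_(t in `[0%R, +oo[) (expR (- (c * t)))%:E)%E; last first.
  by apply: eq_integral => t; rewrite inE /= in_itv /= andbT => t0; rewrite ger0_norm.
have dF t : is_derive t 1 (fun t => - expR (- (c * t)) / c) (expR (- (c * t))).
  apply: is_derive_eq; rewrite /GRing.scale /=; field; exact: lt0r_neq0.
rewrite (@ge0_continuous_FTC2y _ _ (fun t => - expR (- (c * t)) / c) 0 0).
- by rewrite -EFinB -EFinM ltry.
- by move=> t _; exact: expR_ge0.
- apply: continuous_subspaceT => t; apply: continuous_comp; last exact: continuous_expR.
  by apply: cvgN; apply: cvgM; [exact: cvg_cst|exact: cvg_id].
- rewrite -[X in _ --> X](mul0r c^-1); apply: cvgM; last exact: cvg_cst.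
  rewrite -oppr0; apply: cvgN.
  have : c * t @[t --> +oo] --> +oo by apply: gt0_cvgMry => //; exact: cvg_id.
  by move=> ct; exact: (cvg_comp _ _ ct (@cvgr_expR R)).
- by move=> t _; exact: ex_derive.
- apply: cvg_at_right_filter.
  have /derivable1_diffP/differentiable_continuous := @ex_derive _ _ _ _ _ _ _ (dF 0).
  exact.
- by move=> t _; rewrite derive1E; exact: derive_val.
Qed.

(** The growth condition used throughout: it yields integrability and makes boundary terms vanish at
    both ends. *)
Definition expdec F :=
  exists A a, 0 < a /\ forall t, normc (F t) <= A * expR (- (a * `|t|)).

(** Each bound holds for all [t] but serves on one half-line: the first for [t < 0], the second for
    [t >= 0]. *)
Lemma expdecI F (A B a b : R) : 0 < a -> 0 < b ->
  (forall t, normc (F t) <= A * expR (a * t)) ->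
  (forall t, normc (F t) <= B * expR (- (b * t))) -> expdec F.
Proof.
move=> a0 b0 h1 h2.
exists (`|A| + `|B|), (Num.min a b); split; first by rewrite lt_min a0 b0.
move=> t; have [t0|t0] := leP 0 t.
- apply: (le_trans (h2 t)).
  rewrite mulrDl -[leLHS]add0r lerD ?mulr_ge0 ?expR_ge0 //.
  apply: (@le_trans _ _ (`|B| * expR (- (b * t)))).
    by rewrite ler_wpM2r ?expR_ge0 // ler_norm.
  by rewrite ler_wpM2l // ler_expR lerN2 ger0_norm // ler_wpM2r // ge_min lexx orbT.
- apply: (le_trans (h1 t)).
  rewrite mulrDl -[leLHS]addr0 lerD ?mulr_ge0 ?expR_ge0 //.
  apply: (@le_trans _ _ (`|A| * expR (a * t))).
    by rewrite ler_wpM2r ?expR_ge0 // ler_norm.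
  rewrite ler_wpM2l // ler_expR ltr0_norm // mulrN opprK ler_wnM2r ?(ltW t0) //.
  by rewrite ge_min lexx.
Qed.

Lemma cintegrable_expdec F : ccontinuous F -> expdec F -> cintegrable setT F.
Proof.
move=> [cr ci] [A [a [a0 h]]].
have ig : mu.-integrable setT (fun t => (A%:E * (expR (- (a * `|t|)))%:E)%E).
  by apply: integrableZl => //; exact: integrable_expR_abs.
have dom t (u : R) : `|u| <= normc (F t) ->
    (`|u%:E| <= `|A%:E * (expR (- (a * `|t|)))%:E|)%E.
  by move=> hu; rewrite -EFinM lee_fin (le_trans hu) // (le_trans (h t)) // ler_norm.
split; apply: le_integrable ig => //.
- by apply/measurable_EFinP; exact: continuous_measurable_fun.
- by move=> t _; apply: dom; exact: Re_le_normc.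
- by apply/measurable_EFinP; exact: continuous_measurable_fun.
- by move=> t _; apply: dom; exact: Im_le_normc.
Qed.

(** * Linearity of the complex integral *)

Section linearity.
Local Notation D := (setT : set R).
Let mD := @measurableT _ (g_sigma_algebraType (R.-ocitv.-measurable)).

Lemma eq_cintegral (E : set R) F G : (forall t, E t -> F t = G t) ->
  cintegral E F = cintegral E G.
Proof.
by move=> FG; apply: complexP => /=; apply: eq_Rintegral => t /set_mem /FG ->.
Qed.

Lemma eq_cintegrable F G : F =1 G ->
  cintegrable D F -> cintegrable D G.
Proof.
move=> FG [hr hi]; split.
- by apply: (eq_integrable mD) hr => // t _; rewrite FG.
- by apply: (eq_integrable mD) hi => // t _; rewrite FG.
Qed.

Lemma cintegrableD F G : cintegrable D F -> cintegrable D G ->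
  cintegrable D (fun t => F t + G t).
Proof.
move=> [fr fi] [gr gi]; split.
- by apply: (eq_integrable mD) (integrableD mD fr gr) => // t _; rewrite /= ReD EFinD.
- by apply: (eq_integrable mD) (integrableD mD fi gi) => // t _; rewrite /= ImD EFinD.
Qed.

Lemma cintegralD F G : cintegrable D F -> cintegrable D G ->
  cintegral D (fun t => F t + G t) = cintegral D F + cintegral D G.
Proof.
move=> [fr fi] [gr gi]; apply: complexP; rewrite ?ReD ?ImD /=.
- by under eq_Rintegral do rewrite ReD; rewrite RintegralD.
- by under eq_Rintegral do rewrite ImD; rewrite RintegralD.
Qed.

Lemma cintegrableZ F z : cintegrable D F -> cintegrable D (fun t => z * F t).
Proof.
move=> [fr fi]; split.
- apply: (eq_integrable mD) (integrableB mD (integrableZl mD (Re z) fr)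
    (integrableZl mD (Im z) fi)) => // t _.
  by rewrite /= ReM EFinB !EFinM.
- apply: (eq_integrable mD) (integrableD mD (integrableZl mD (Re z) fi)
    (integrableZl mD (Im z) fr)) => // t _.
  by rewrite /= ImM EFinD !EFinM.
Qed.

Lemma cintegralZ F z : cintegrable D F ->
  cintegral D (fun t => z * F t) = z * cintegral D F.
Proof.
move=> [fr fi].
have zr (u : R) := integrableZl mD u fr.
have zi (u : R) := integrableZl mD u fi.
apply: complexP; rewrite ?ReM ?ImM /=.
- under eq_Rintegral do rewrite ReM.
  rewrite RintegralB //; [|exact: zr|exact: zi].
  by rewrite !RintegralZl.
- under eq_Rintegral do rewrite ImM.
  rewrite RintegralD //; [|exact: zi|exact: zr].
  by rewrite !RintegralZl.
Qed.

Lemma cintegralN F : cintegrable D F ->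
  cintegral D (fun t => - F t) = - cintegral D F.
Proof.
move=> iF; rewrite -mulN1r -cintegralZ //.
by apply: eq_cintegral => t _; rewrite mulN1r.
Qed.

Lemma cintegrableN F : cintegrable D F -> cintegrable D (fun t => - F t).
Proof.
move=> iF; apply: (@eq_cintegrable (fun t => (-1) * F t)); last exact: cintegrableZ.
by move=> t; rewrite mulN1r.
Qed.

Lemma cintegralB F G : cintegrable D F -> cintegrable D G ->
  cintegral D (fun t => F t - G t) = cintegral D F - cintegral D G.
Proof.
by move=> iF iG; rewrite cintegralD ?cintegralN //; exact: cintegrableN.
Qed.

Lemma cintegrable0 : cintegrable D (fun=> 0).
Proof. by split; exact: integrable0. Qed.

Lemma cintegral0 : cintegral D (fun=> 0) = 0.
Proof. by apply: complexP => /=; rewrite /Rintegral integral0. Qed.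

Lemma cintegrable_sum (T : Type) (r : seq T) (h : T -> R -> R[i]) :
  (forall i, cintegrable D (h i)) -> cintegrable D (fun t => \sum_(i <- r) h i t).
Proof.
move=> ih; elim: r => [|i r IH].
  by under eq_fun do rewrite big_nil; exact: cintegrable0.
by under eq_fun do rewrite big_cons; exact: cintegrableD.
Qed.

Lemma cintegral_sum (T : Type) (r : seq T) (h : T -> R -> R[i]) :
  (forall i, cintegrable D (h i)) ->
  cintegral D (fun t => \sum_(i <- r) h i t) = \sum_(i <- r) cintegral D (h i).
Proof.
move=> ih; elim: r => [|i r IH].
  by under eq_fun do rewrite big_nil; rewrite big_nil cintegral0.
under eq_fun do rewrite big_cons; rewrite big_cons cintegralD ?IH //.
exact: cintegrable_sum.
Qed.

End linearity.

Lemma expdec_cvg F : expdec F ->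
  [/\ Re (F t) @[t --> +oo] --> 0, Re (F t) @[t --> -oo] --> 0,
      Im (F t) @[t --> +oo] --> 0 & Im (F t) @[t --> -oo] --> 0].
Proof.
move=> [A [a [a0 h]]].
have py : A * expR (- (a * t)) @[t --> +oo] --> 0.
  rewrite -[X in _ --> X](mulr0 A); apply: cvgM; first exact: cvg_cst.
  have ct : a * t @[t --> +oo] --> +oo by apply: gt0_cvgMry => //; exact: cvg_id.
  exact: (cvg_comp _ _ ct (@cvgr_expR R)).
have pN : A * expR (a * t) @[t --> -oo] --> 0.
  have Ny : (- t : R) @[t --> -oo] --> +oo by apply/cvgNry; exact: cvg_id.
  have := cvg_comp _ _ Ny py; apply: cvg_trans; apply: near_eq_cvg.
  by near=> t; rewrite /= mulrN opprK.
have sq (f : R -> R) (K : set_system R) (g : R -> R) : ProperFilter K ->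
    (\forall t \near K, `|f t| <= g t) -> g t @[t --> K] --> 0 -> f t @[t --> K] --> 0.
  move=> PK fg g0; apply: norm_cvg0.
  apply: (@squeeze_cvgr _ _ _ _ (fun=> 0) g) => //; last exact: cvg_cst.
  by apply: filterS fg => t ->; rewrite normr_ge0.
have hy t : 0 <= t -> normc (F t) <= A * expR (- (a * t)).
  by move=> t0; rewrite (le_trans (h t)) // ger0_norm.
have hN t : t <= 0 -> normc (F t) <= A * expR (a * t).
  by move=> t0; rewrite (le_trans (h t)) // ler0_norm // mulrN opprK.
split.
- apply: (sq _ _ _ _ _ py); near=> t; apply: le_trans (Re_le_normc _) (hy _ _).
  by near: t; exact: nbhs_pinfty_ge.
- apply: (sq _ _ _ _ _ pN); near=> t; apply: le_trans (Re_le_normc _) (hN _ _).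
  by near: t; exact: nbhs_ninfty_le.
- apply: (sq _ _ _ _ _ py); near=> t; apply: le_trans (Im_le_normc _) (hy _ _).
  by near: t; exact: nbhs_pinfty_ge.
- apply: (sq _ _ _ _ _ pN); near=> t; apply: le_trans (Im_le_normc _) (hN _ _).
  by near: t; exact: nbhs_ninfty_le.
Unshelve. all: by end_near. Qed.

(** The form in which integration by parts is used below: proving a linear relation between
    integrals amounts to exhibiting a decaying primitive of the corresponding combination of
    integrands. *)
Lemma cintegral_derive F (F' : R -> R[i]) : (forall t, is_cderive F t (F' t)) ->
  ccontinuous F' -> cintegrable setT F' -> expdec F -> cintegral setT F' = 0.
Proof.
move=> dF [cr ci] [ir ii] /expdec_cvg[r1 r2 i1 i2].
apply: complexP => /=.
- rewrite -[RHS](subr0 0).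
  by apply: (@Rintegral_FTC _ (fun t => Re (F t))) => // t; case: (dF t).
- rewrite -[RHS](subr0 0).
  by apply: (@Rintegral_FTC _ (fun t => Im (F t))) => // t; case: (dF t).
Qed.

Lemma cintegral_affine F (a b : R) : 0 < a -> ccontinuous F ->
  cintegrable setT (fun t => F (b + a * t)) ->
  cintegrable setT F /\
  cintegral setT F = a%:C * cintegral setT (fun t => F (b + a * t)).
Proof.
move=> a0 [cr ci] [ir ii].
have i1 := integrableZr measurableT a ir.
have i2 := integrableZr measurableT a ii.
have [j1 e1] := Rintegral_affine a0 cr i1.
have [j2 e2] := Rintegral_affine a0 ci i2.
split; first by split.
apply: complexP; rewrite ?ReM ?ImM /= ?mul0r ?subr0 ?addr0.
- by rewrite e1 mulrC RintegralZr.
- by rewrite e2 mulrC RintegralZr.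
Qed.

Lemma cintegral_expR F :
  (forall u : R, 0 < u -> {for u, continuous (fun u : R => Re (F u))}) ->
  (forall u : R, 0 < u -> {for u, continuous (fun u : R => Im (F u))}) ->
  cintegrable setT (fun t => F (expR t) * (expR t)%:C) ->
  cintegrable `]0, +oo[ F /\
  cintegral `]0, +oo[ F = cintegral setT (fun t => F (expR t) * (expR t)%:C).
Proof.
move=> cr ci [ir ii].
have re t : Re (F (expR t) * (expR t)%:C) = Re (F (expR t)) * expR t.
  by rewrite ReM /= mulr0 subr0.
have im t : Im (F (expR t) * (expR t)%:C) = Im (F (expR t)) * expR t.
  by rewrite ImM /= mulr0 add0r.
have [] := @integral_expR (fun x => Re (F x)) cr.
  by apply: eq_integrable ir => // t _; rewrite re.
have [] := @integral_expR (fun x => Im (F x)) ci.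
  by apply: eq_integrable ii => // t _; rewrite im.
move=> ji ei jr er; split => //; apply: complexP => /=.
- by rewrite er; apply: eq_Rintegral => t _; rewrite re.
- by rewrite ei; apply: eq_Rintegral => t _; rewrite im.
Qed.

End Integration.

(** * Rotating the line of integration *)

Section Rotation.
Context {R : realType}.
Implicit Types (z w a : R[i]) (t s : R) (F G : R -> R[i]).
Local Notation mu := (@lebesgue_measure R).

Lemma Re_cexp z : Re (cexp z) = expR (Re z) * cos (Im z). Proof. by []. Qed.
Lemma Im_cexp z : Im (cexp z) = expR (Re z) * sin (Im z). Proof. by []. Qed.
Lemma Re_cintegral (D : set R) F : Re (cintegral D F) = \int[mu]_(t in D) Re (F t).
Proof. by []. Qed.
Lemma Im_cintegral (D : set R) F : Im (cintegral D F) = \int[mu]_(t in D) Im (F t).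
Proof. by []. Qed.

(* [(exp t) ^ a] *)
Definition ce a t : R[i] := cexp (a * t%:C).

Lemma is_cderive_ce a t : is_cderive (ce a) t (a * ce a t).
Proof.
apply: is_cderive_eq.
  by apply: is_cderive_ext (is_cderive_cexp 0 a t) => s; rewrite add0r.
by rewrite add0r.
Qed.
Lemma ccontinuous_ce a : ccontinuous (ce a).
Proof. by apply: is_cderive_continuous => t; exact: is_cderive_ce. Qed.
Lemma normc_ce a t : normc (ce a t) = expR (Re a * t).
Proof. by rewrite normc_cexp ReM /= mulr0 subr0. Qed.
Lemma ceD a b t : ce (a + b) t = ce a t * ce b t.
Proof. by rewrite /ce mulrDl cexpD. Qed.
Lemma ce_addt a t s : ce a (t + s) = ce a t * ce a s.
Proof. by rewrite /ce rmorphD mulrDr cexpD. Qed.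
Lemma ce1 t : ce 1 t = (expR t)%:C.
Proof. by rewrite /ce mul1r cexp_real. Qed.
Lemma ce_nat n t : ce n%:R t = ((expR t)%:C) ^+ n.
Proof. by rewrite /ce cexp_natl cexp_real. Qed.
Lemma real_gt0_neq0 t : 0 < t -> t%:C != 0 :> R[i].
Proof. by move=> t0; rewrite -normc_eq0 normc_real normr_eq0 gt_eqF. Qed.
Lemma onePexp_neq0 t : 1 + (expR t)%:C != 0 :> R[i].
Proof.
rewrite -[X in X + _](rmorph1 (real_complex R)) -rmorphD.
by apply: real_gt0_neq0; rewrite addr_gt0 // expR_gt0.
Qed.
Lemma onePexp2_neq0 t : 1 + (expR t)%:C ^+ 2 != 0 :> R[i].
Proof.
rewrite -[X in X + _](rmorph1 (real_complex R)) -rmorphXn -rmorphD.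
by apply: real_gt0_neq0; rewrite addr_gt0 // exprn_gt0 // expR_gt0.
Qed.

(** The majorant behaves like [exp (c t)] at minus infinity and like [exp (- (2 - c) t)] at plus
    infinity. *)
Lemma expdec_kernel F (A c : R) : 0 < c < 2 ->
  (forall t, normc (F t) <= A * (expR (c * t) / (1 + expR t ^+ 2))) -> expdec F.
Proof.
move=> /andP[c0 c2] h.
have A0 : 0 <= A.
  have := le_trans (normc_ge0 _) (h 0); by rewrite pmulr_lge0 // divr_gt0 ?expR_gt0.
have d0 t : 0 < 1 + expR t ^+ 2 by rewrite addr_gt0 // exprn_gt0 // expR_gt0.
apply: (@expdecI _ _ A A c (2 - c)) => //; first by rewrite subr_gt0.
- move=> t; apply: (le_trans (h t)); rewrite ler_wpM2l //.
  rewrite ler_pdivrMr // ler_peMr ?expR_ge0 //.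
  by rewrite lerDl exprn_ge0 // expR_ge0.
- move=> t; apply: (le_trans (h t)); rewrite ler_wpM2l //.
  rewrite ler_pdivrMr //.
  apply: (@le_trans _ _ (expR (- ((2 - c) * t)) * expR t ^+ 2)).
    rewrite -expRM_natl -expRD ler_expR; lra.
  by rewrite ler_wpM2l ?expR_ge0 // lerDr.
Qed.

Lemma integrable_kernel (c : R) : 0 < c < 2 ->
  mu.-integrable setT (fun t => (expR (c * t) / (1 + expR t ^+ 2))%:E).
Proof.
move=> c02; pose G t := expR (c * t) / (1 + expR t ^+ 2).
have [] // : cintegrable setT (fun t => (G t)%:C).
apply: cintegrable_expdec.
  apply: ccontinuous_real => t; apply: cvgM.
    apply: continuous_comp; last exact: continuous_expR.
    by apply: cvgM; [exact: cvg_cst|exact: cvg_id].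
  apply: cvgV; first by rewrite gt_eqF // addr_gt0 // exprn_gt0 // expR_gt0.
  apply: cvgD; first exact: cvg_cst.
  by apply: cvgM; exact: continuous_expR.
apply: (@expdec_kernel _ 1 _ c02) => t; rewrite mul1r normc_real ger0_norm //.
by rewrite divr_ge0 ?expR_ge0 // addr_ge0 // exprn_ge0 // expR_ge0.
Qed.

(** The integrand of the beta integral, with [a = w + 1], continued to complex [z]; [rot'] is its
    complex derivative. *)
Definition rot a z : R[i] := cexp (a * z) / (1 + cexp z) ^+ 2.
Definition rot' a z : R[i] :=
  a * rot a z - 2%:R * (cexp z / (1 + cexp z)) * rot a z.

Lemma is_cderive_rot a z d t : 1 + cexp (z + d * t%:C) != 0 ->
  is_cderive (fun s => rot a (z + d * s%:C)) t (d * rot' a (z + d * t%:C)).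
Proof.
move=> n0.
have d1 : is_cderive (fun s => cexp (a * (z + d * s%:C))) t
    (a * d * cexp (a * (z + d * t%:C))).
  apply: is_cderive_eq.
    apply: is_cderive_ext (is_cderive_cexp (a * z) (a * d) t) => s.
    by rewrite mulrDr mulrA.
  by rewrite mulrDr !mulrA.
have d2 := is_cderiveV n0 (is_cderiveD (is_cderive_cst 1 t) (is_cderive_cexp z d t)).
apply: is_cderive_eq.
  apply: is_cderive_ext (is_cderiveM d1 (is_cderiveM d2 d2)) => s.
  by rewrite /rot expr2 invfM.
by rewrite /rot' /rot; field.
Qed.

Definition pt t s : R[i] := t%:C + 'i%C * s%:C.

Lemma Re_pt t s : Re (pt t s) = t.
Proof. by rewrite /pt !ReImE /=; ring. Qed.
Lemma Im_pt t s : Im (pt t s) = s.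
Proof. by rewrite /pt !ReImE /=; ring. Qed.

(** * Uniform bounds for [|Im z| < v] *)

Section sector.
Variables (v : R).
Hypothesis v0pi : 0 < v < pi.

(** The number [k - 1] is at most 0 and bounds [cos s] from below for [|s| < v]. As [v] tends to
    [pi], where [1 + exp z] has a zero, [k] tends to 0. *)
Definition sector_cst := 1 + Num.min (cos v) 0.
Local Notation k := sector_cst.

Lemma sector_cst_gt0 : 0 < k.
Proof.
case/andP: v0pi => v0 vpi.
rewrite /k addrC -ltrBlDr sub0r lt_min ltrN10 andbT -cospi ltr_cos //.
  by rewrite in_itv /= !ltW.
by rewrite in_itv /= pi_ge0 lexx.
Qed.

Lemma sector_cst_le1 : k <= 1.
Proof. by rewrite /k gerDl ge_min lexx orbT. Qed.

(** With [e = exp t], the right side is [1 + 2 e cos s + e ^ 2], which is at least [1 + 2 (k - 1) e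
    + e ^ 2 = k (1 + e ^ 2) + (1 - k) (1 - e) ^ 2]. *)
Lemma sector_bound t s : `|s| < v ->
  k * (1 + expR t ^+ 2) <= normc (1 + cexp (pt t s)) ^+ 2.
Proof.
move=> sv; case/andP: v0pi => v0 vpi.
rewrite normc_sqr ReD ImD Re_cexp Im_cexp Re_pt Im_pt [Re 1]/= [Im 1]/=.
have -> : (1 + expR t * cos s) ^+ 2 + (0 + expR t * sin s) ^+ 2 =
    1 + 2 * expR t * cos s + expR t ^+ 2.
  have := cos2Dsin2 s; move: (cos s) (sin s) (expR t) => c d e h.
  have -> : e ^+ 2 = e ^+ 2 * (c ^+ 2 + d ^+ 2) by rewrite h mulr1.
  ring.
have cs : cos v < cos s.
  rewrite -(cos_norm s) ltr_cos // in_itv /= ?normr_ge0 ?(ltW v0) ?(ltW vpi) //=.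
  exact/ltW/(lt_trans sv).
have km : k - 1 <= cos s by rewrite /k addrC addKr ge_min (ltW cs).
have k1 : k - 1 <= 0 by rewrite subr_le0 sector_cst_le1.
have e0 : 0 < expR t := expR_gt0 t.
move: (expR t) (cos s) e0 km k1 => e c e0 km k1.
have h1 : 0 <= e * (c - (k - 1)) by rewrite mulr_ge0 ?subr_ge0 // ltW.
have h2 : 0 <= (1 - k) * (1 - e) ^+ 2 by rewrite mulr_ge0 ?sqr_ge0 // -oppr_le0 opprB.
move: h1 h2; rewrite /= => h1 h2; nra.
Qed.

Lemma sector_neq0 t s : `|s| < v -> 1 + cexp (pt t s) != 0.
Proof.
move=> sv; rewrite -normc_eq0 -sqrf_eq0 gt_eqF //.
apply: lt_le_trans (sector_bound t sv).
by rewrite mulr_gt0 ?sector_cst_gt0 // addr_gt0 // exprn_gt0 // expR_gt0.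
Qed.

Variable a : R[i].
Hypothesis a02 : 0 < Re a < 2.

Lemma rot_bound t s : `|s| < v ->
  normc (rot a (pt t s)) <=
    expR (`|Im a| * v) / k * (expR (Re a * t) / (1 + expR t ^+ 2)).
Proof.
move=> sv; have k0 := sector_cst_gt0; have b := sector_bound t sv.
have e0 : 0 < 1 + expR t ^+ 2 by rewrite addr_gt0 // exprn_gt0 // expR_gt0.
rewrite /rot ComplexField.Normc.normcM ComplexField.Normc.normcV normcX normc_cexp.
rewrite ReM Re_pt Im_pt expRD.
have -> : expR (`|Im a| * v) / k * (expR (Re a * t) / (1 + expR t ^+ 2)) =
  expR (Re a * t) * expR (`|Im a| * v) / (k * (1 + expR t ^+ 2)).
  by rewrite invfM; ring.
apply: ler_pM.
- by rewrite mulr_ge0 ?expR_ge0.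
- by rewrite invr_ge0 sqr_ge0.
- rewrite ler_wpM2l ?expR_ge0 // ler_expR.
  rewrite (le_trans (ler_norm _)) // normrN normrM.
  by rewrite ler_wpM2l // ltW.
- have kp : 0 < k * (1 + expR t ^+ 2) by rewrite mulr_gt0.
  by rewrite lef_pV2 ?posrE // (lt_le_trans kp).
Qed.

(** The logarithmic derivative of [rot a] is [a - 2 exp z / (1 + exp z)], and the sector bound makes
    the quotient at most [1 / k] in modulus. *)
Lemma rot'_bound t s : `|s| < v ->
  normc (rot' a (pt t s)) <= (normc a + 2 / k) * normc (rot a (pt t s)).
Proof.
move=> sv; have k0 := sector_cst_gt0; have k1 := sector_cst_le1.
have b := sector_bound t sv; have n0 := sector_neq0 t sv.
rewrite /rot' -mulNr -mulrDl ComplexField.Normc.normcM ler_wpM2r ?normc_ge0 //.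
rewrite (le_trans (le_normcD _ _)) // lerD2l normcN ComplexField.Normc.normcM.
rewrite -natc normc_real ger0_norm ?ler0n // ler_wpM2l ?ler0n //.
rewrite ComplexField.Normc.normcM ComplexField.Normc.normcV normc_cexp Re_pt.
have p0 : 0 < normc (1 + cexp (pt t s)).
  by rewrite lt_def normc_ge0 normc_eq0 n0.
rewrite ler_pdivrMr // ler_pdivlMl //.
rewrite -(@ler_pXn2r _ 2) ?nnegrE ?normc_ge0 ?mulr_ge0 ?expR_ge0 ?(ltW k0) //.
apply: le_trans b; rewrite exprMn.
have := sqr_ge0 (expR t); move: (expR t ^+ 2) => e e0.
have : 0 <= k * (1 - k) * e by rewrite !mulr_ge0 ?subr_ge0 // ltW.
move: k k0 => q q0; nra.
Qed.

Lemma expdec_rot s : `|s| < v -> expdec (fun t => rot a (pt t s)).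
Proof. by move=> sv; apply: expdec_kernel a02 _ => t; exact: rot_bound. Qed.

Lemma rot'_kernel t s : `|s| < v ->
  normc (rot' a (pt t s)) <= (normc a + 2 / k) * (expR (`|Im a| * v) / k) *
     (expR (Re a * t) / (1 + expR t ^+ 2)).
Proof.
move=> sv; rewrite (le_trans (rot'_bound t sv)) // -mulrA ler_wpM2l ?rot_bound //.
by rewrite addr_ge0 ?normc_ge0 // divr_ge0 ?ler0n // ltW // sector_cst_gt0.
Qed.

Lemma expdec_rot' s : `|s| < v -> expdec (fun t => rot' a (pt t s)).
Proof. by move=> sv; apply: expdec_kernel a02 _ => t; exact: rot'_kernel. Qed.

Lemma is_cderive_rot_t t s : `|s| < v ->
  is_cderive (fun u => rot a (pt u s)) t (rot' a (pt t s)).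
Proof.
move=> sv; have e u : pt u s = 'i%C * s%:C + 1 * u%:C by rewrite /pt mul1r addrC.
apply: is_cderive_eq.
  apply: (@is_cderive_ext _ (fun u => rot a ('i%C * s%:C + 1 * u%:C))).
    by move=> u; rewrite e.
  by apply: is_cderive_rot; rewrite -e; exact: sector_neq0.
by rewrite mul1r e.
Qed.

Lemma is_cderive_rot_s t s : `|s| < v ->
  is_cderive (fun u => rot a (pt t u)) s ('i%C * rot' a (pt t s)).
Proof. by move=> sv; apply: is_cderive_rot; exact: sector_neq0. Qed.

Lemma ccontinuous_rot s : `|s| < v -> ccontinuous (fun t => rot a (pt t s)).
Proof.
by move=> sv; apply: is_cderive_continuous => t; exact: is_cderive_rot_t.
Qed.

Lemma ccontinuous_rot' s : `|s| < v -> ccontinuous (fun t => rot' a (pt t s)).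
Proof.
move=> sv; have c1 := ccontinuous_rot sv.
have c2 : ccontinuous (fun t => cexp (pt t s)).
  apply: eq_ccontinuous (ccontinuous_cexp ('i%C * s%:C) 1) => t.
  by rewrite /pt mul1r addrC.
apply: ccontinuousB; first by apply: ccontinuousM => //; exact: ccontinuous_cst.
apply: ccontinuousM => //; apply: ccontinuousM; first exact: ccontinuous_cst.
apply: ccontinuousM => //; apply: ccontinuousV; first by move=> t; exact: sector_neq0.
by apply: ccontinuousD => //; exact: ccontinuous_cst.
Qed.

Lemma cintegrable_rot s : `|s| < v -> cintegrable setT (fun t => rot a (pt t s)).
Proof.
move=> sv; apply: cintegrable_expdec; [exact: ccontinuous_rot|exact: expdec_rot].
Qed.

Lemma cintegral_rot' s : `|s| < v -> cintegral setT (fun t => rot' a (pt t s)) = 0.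
Proof.
move=> sv; apply: (@cintegral_derive _ (fun t => rot a (pt t s))).
- by move=> t; exact: is_cderive_rot_t.
- exact: ccontinuous_rot'.
- by apply: cintegrable_expdec; [exact: ccontinuous_rot'|exact: expdec_rot'].
- exact: expdec_rot.
Qed.

(** Differentiation under the integral sign: the kernel bound on [rot'] does not depend on [s],
    hence dominates on the whole range. A real-valued [h] covers both the real and the imaginary
    part. *)
Let is_derive_integral (h h' : R -> R -> R) s :
  (forall u : R, `|u| < v -> mu.-integrable setT (EFin \o h u)) ->
  (forall u t : R, `|u| < v -> is_derive u 1 (h ^~ t) (h' u t)) ->
  (forall u t : R, `|u| < v -> `|h' u t| <= normc (rot' a (pt t u))) ->
  `|s| < v -> is_derive s 1 (fun u => \int[mu]_t h u t) (\int[mu]_t h' s t).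
Proof.
move=> ih dh bh sv.
have inv (u : R) : (`](- v), v[%classic u : Prop) -> `|u| < v.
  by rewrite /= in_itv /= ltr_norml.
pose G t := (normc a + 2 / k) * (expR (`|Im a| * v) / k) *
     (expR (Re a * t) / (1 + expR t ^+ 2)).
have G0 t : 0 <= G t.
  by apply: le_trans (normc_ge0 _) (@rot'_kernel t 0 _); rewrite normr0; case/andP: v0pi.
have iG : mu.-integrable setT (EFin \o G).
  exact: (integrableZl measurableT _ (integrable_kernel a02)).
have sI : `](- v), v[%classic s by rewrite /= in_itv /= -ltr_norml.
have der u t : `](- v), v[%classic u -> setT t -> derivable (h ^~ t) u 1.
  by move=> /inv uv _; have := dh u t uv => -[].
have dE u t : `|u| < v -> partial1of2 h u t = h' u t.
  by move=> uv; rewrite partial1of2E; have := dh u t uv => -[].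
have ub u t : `](- v), v[%classic u -> setT t -> `|partial1of2 h u t| <= G t.
  move=> /inv uv _; rewrite dE // (le_trans (bh u t uv)) //; exact: rot'_kernel.
have ih' u : `](- v), v[%classic u -> mu.-integrable setT (EFin \o h u).
  by move=> /inv; exact: ih.
split.
  exact: (derivable_under_integral measurableT sI ih' der G0 iG ub).
rewrite -derive1E (differentiation_under_integral measurableT sI ih' der G0 iG ub).
by apply: eq_Rintegral => t _; rewrite dE.
Qed.

Let constant (g : R -> R) s :
  (forall u : R, `|u| < v -> is_derive u 1 g 0) -> `|s| < v -> g s = g 0.
Proof.
move=> dg sv.
suff H x y : `|x| < v -> `|y| < v -> x < y -> g y = g x.
  have [s0|s0|->] := ltgtP s 0 => //; last by apply: H => //; rewrite normr0; case/andP: v0pi.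
  by apply/esym/H => //; rewrite normr0; case/andP: v0pi.
move=> xv yv xy.
have inv (u : R) : x <= u <= y -> `|u| < v.
  move: xv yv; rewrite !ltr_norml => /andP[h1 _] /andP[_ h2] /andP[h3 h4].
  by rewrite (lt_le_trans h1) //= (le_lt_trans h4).
have c : {within `[x, y], continuous g}.
  apply: derivable_within_continuous => u; rewrite in_itv /= => /inv uv.
  by have := dg u uv => -[].
have [|? _ h] := @MVT R g (fun=> 0) x y xy _ c.
  move=> u; rewrite in_itv /= => /andP[h1 h2]; apply: dg; apply: inv.
  by rewrite !ltW.
by apply/eqP; rewrite -subr_eq0 h mul0r.
Qed.

(* By the Cauchy-Riemann equation the derivative in [s] is ['i] times a derivative in [t],
   whose integral vanishes. *)
Lemma cintegral_rot s : `|s| < v ->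
  cintegral setT (fun t => rot a (pt t s)) = cintegral setT (fun t => rot a (pt t 0)).
Proof.
move=> sv; apply: complexP; rewrite ?Re_cintegral ?Im_cintegral.
- apply: (@constant (fun s => \int[mu]_t Re (rot a (pt t s)))) => // u uv.
  have := @is_derive_integral (fun u t => Re (rot a (pt t u)))
    (fun u t => Re ('i%C * rot' a (pt t u))) u.
  have -> : \int[mu]_t Re ('i%C * rot' a (pt t u)) = 0.
    have [ir ii] : cintegrable setT (fun t => rot' a (pt t u)).
      by apply: cintegrable_expdec; [exact: ccontinuous_rot'|exact: expdec_rot'].
    rewrite -Re_cintegral cintegralZ; last by split.
    by rewrite cintegral_rot' // mulr0.
  apply => //.
  + by move=> x xv; case: (cintegrable_rot xv).
  + by move=> x t xv; case: (is_cderive_rot_s t xv).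
  + move=> x t xv; rewrite ReM /= mul0r mul1r sub0r normrN; exact: Im_le_normc.
- apply: (@constant (fun s => \int[mu]_t Im (rot a (pt t s)))) => // u uv.
  have := @is_derive_integral (fun u t => Im (rot a (pt t u)))
    (fun u t => Im ('i%C * rot' a (pt t u))) u.
  have -> : \int[mu]_t Im ('i%C * rot' a (pt t u)) = 0.
    have [ir ii] : cintegrable setT (fun t => rot' a (pt t u)).
      by apply: cintegrable_expdec; [exact: ccontinuous_rot'|exact: expdec_rot'].
    rewrite -Im_cintegral cintegralZ; last by split.
    by rewrite cintegral_rot' // mulr0.
  apply => //.
  + by move=> x xv; case: (cintegrable_rot xv).
  + by move=> x t xv; case: (is_cderive_rot_s t xv).
  + move=> x t xv; rewrite ImM /= mul0r mul1r add0r; exact: Re_le_normc.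
Qed.

End sector.
End Rotation.

(** * The functional equation of the beta integral *)

Section Reflection.
Context {R : realType}.
Implicit Types (z w a : R[i]) (t s : R) (F G : R -> R[i]).
Local Notation mu := (@lebesgue_measure R).

Lemma realcD t s : (t + s)%:C = t%:C + s%:C :> R[i]. Proof. exact: rmorphD. Qed.
Lemma realcN t : (- t)%:C = - t%:C :> R[i]. Proof. exact: rmorphN. Qed.
Lemma realcM t s : (t * s)%:C = t%:C * s%:C :> R[i]. Proof. exact: rmorphM. Qed.
Lemma realcV t : t^-1%:C = t%:C^-1 :> R[i]. Proof. exact: fmorphV. Qed.
Lemma realcX t n : (t ^+ n)%:C = t%:C ^+ n :> R[i]. Proof. exact: rmorphXn. Qed.
Lemma realc1 : 1%:C = 1 :> R[i]. Proof. by []. Qed.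

(* [\int_0^oo u ^ w / (1 + u) ^ 2 du], with [u = exp t] *)
Definition betaK w : R[i] :=
  cintegral setT (fun t => ce (w + 1) t / (1 + (expR t)%:C) ^+ 2).

Lemma Re_addn w (n : nat) : Re (w + n%:R) = Re w + n%:R.
Proof. by rewrite ReD Re_nat. Qed.

Lemma normc_1Dexp t : normc (1 + (expR t)%:C) = 1 + expR t.
Proof.
by rewrite -[X in X + _](rmorph1 (real_complex R)) -rmorphD normc_real ger0_norm.
Qed.

Lemma normc_1Dexp2 t : normc (1 + (expR t)%:C ^+ 2) = 1 + expR t ^+ 2.
Proof.
by rewrite -[X in X + _](rmorph1 (real_complex R)) -rmorphXn -rmorphD normc_real ger0_norm.
Qed.

Lemma ccontinuous_1Dexp : ccontinuous (fun t => 1 + (expR t)%:C).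
Proof.
apply: ccontinuousD; first exact: ccontinuous_cst.
by apply: ccontinuous_real; exact: continuous_expR.
Qed.

Lemma ccontinuous_1Dexp2 : ccontinuous (fun t => 1 + (expR t)%:C ^+ 2).
Proof.
apply: ccontinuousD; first exact: ccontinuous_cst.
by apply: ccontinuousX; apply: ccontinuous_real; exact: continuous_expR.
Qed.

Lemma ccontinuous_betaK w : ccontinuous (fun t => ce (w + 1) t / (1 + (expR t)%:C) ^+ 2).
Proof.
apply: ccontinuousM; first exact: ccontinuous_ce.
apply: ccontinuousV; first by move=> t; rewrite expf_neq0 // onePexp_neq0.
exact/ccontinuousX/ccontinuous_1Dexp.
Qed.

Lemma normc_betaK w t : normc (ce (w + 1) t / (1 + (expR t)%:C) ^+ 2) =
  expR ((Re w + 1) * t) / (1 + expR t) ^+ 2.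
Proof.
rewrite ComplexField.Normc.normcM ComplexField.Normc.normcV normcX normc_1Dexp normc_ce.
by rewrite (Re_addn w 1).
Qed.

Lemma sqr_1Dexp_ge t : 1 + expR t ^+ 2 <= (1 + expR t) ^+ 2.
Proof. by have := expR_gt0 t; move: (expR t) => e e0; nra. Qed.

Lemma betaK_dom w t : normc (ce (w + 1) t / (1 + (expR t)%:C) ^+ 2) <=
  1 * (expR ((Re w + 1) * t) / (1 + expR t ^+ 2)).
Proof.
rewrite mul1r normc_betaK ler_wpM2l ?expR_ge0 //.
have p : 0 < 1 + expR t ^+ 2 by rewrite addr_gt0 // exprn_gt0 // expR_gt0.
by rewrite lef_pV2 ?posrE ?sqr_1Dexp_ge // (lt_le_trans p (sqr_1Dexp_ge t)).
Qed.

Lemma cintegrable_betaK w : -1 < Re w < 1 ->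
  cintegrable setT (fun t => ce (w + 1) t / (1 + (expR t)%:C) ^+ 2).
Proof.
move=> /andP[w1 w2]; apply: cintegrable_expdec; first exact: ccontinuous_betaK.
apply: (@expdec_kernel _ _ 1 (Re w + 1)); last exact: betaK_dom.
by rewrite -ltrBlDr sub0r w1 -ltrBrDr; lra.
Qed.

(** This denominator appears because the rotated ones, [1 + i exp t] and [1 - i exp t], have product
    [1 + exp (2 t)]. *)
Definition quadX a : R[i] := cintegral setT (fun t => ce a t / (1 + (expR t)%:C ^+ 2) ^+ 2).

Lemma ccontinuous_quadX a : ccontinuous (fun t => ce a t / (1 + (expR t)%:C ^+ 2) ^+ 2).
Proof.
apply: ccontinuousM; first exact: ccontinuous_ce.
apply: ccontinuousV; first by move=> t; rewrite expf_neq0 // onePexp2_neq0.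
exact/ccontinuousX/ccontinuous_1Dexp2.
Qed.

Lemma cintegrable_quadX a : 0 < Re a < 4 ->
  cintegrable setT (fun t => ce a t / (1 + (expR t)%:C ^+ 2) ^+ 2).
Proof.
move=> /andP[a0 a4]; apply: cintegrable_expdec; first exact: ccontinuous_quadX.
have nE t : normc (ce a t / (1 + (expR t)%:C ^+ 2) ^+ 2) =
    expR (Re a * t) / (1 + expR t ^+ 2) ^+ 2.
  by rewrite ComplexField.Normc.normcM ComplexField.Normc.normcV normcX normc_1Dexp2 normc_ce.
have p t : 0 < (1 + expR t ^+ 2) ^+ 2 by rewrite exprn_gt0 // addr_gt0 // exprn_gt0 // expR_gt0.
apply: (@expdecI _ _ 1 1 (Re a) (4 - Re a)); rewrite ?subr_gt0 // => t; rewrite mul1r nE.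
- rewrite ler_pdivrMr // ler_peMr ?expR_ge0 // exprn_ege1 // lerDl.
  by rewrite exprn_ge0 // expR_ge0.
- rewrite ler_pdivrMr //.
  apply: (@le_trans _ _ (expR (- ((4 - Re a) * t)) * (expR t ^+ 2) ^+ 2)).
    rewrite -exprM -expRM_natl -expRD ler_expR; lra.
  rewrite ler_wpM2l ?expR_ge0 // lerXn2r ?nnegrE ?addr_ge0 ?exprn_ge0 ?expR_ge0 //.
  by rewrite lerDr.
Qed.

Lemma cexp_ipihalf : cexp ('i%C * (pi / 2)%:C : R[i]) = 'i%C.
Proof.
apply: complexP; rewrite ?Re_cexp ?Im_cexp !ReImE [Re _]/= [Im _]/=.
all: rewrite /= ?mul0r ?mul1r ?subr0 ?addr0 ?add0r ?mulr0 ?subr0 ?oppr0 ?expR0 ?mul1r.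
all: by rewrite ?cos_pihalf ?sin_pihalf.
Qed.

Lemma i_neq0 : 'i%C != 0 :> R[i].
Proof. by rewrite -cexp_ipihalf cexp_neq0. Qed.

Lemma invi : ('i%C)^-1 = - 'i%C :> R[i].
Proof. by apply: (mulfI i_neq0); rewrite mulfV ?i_neq0 // mulrN -expr2 sqr_i opprK. Qed.

(** Both rotated integrals equal [betaK w]. Each is weighted by the phase that cancels its own, and
    they add up through [(1 - i e) ^ -2 + (1 + i e) ^ -2 = 2 (1 - e ^ 2) / (1 + e ^ 2) ^ 2]; the
    weights sum to [2 cos (pi (w + 1) / 2) = - 2 sin (pi w / 2)]. *)
Lemma betaK_sum_rotations w : -1 < Re w < 1 ->
  csin (pi%:C * w / 2%:R) * betaK w = quadX (w + 3%:R) - quadX (w + 1).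
Proof.
move=> w11; set a := w + 1.
have a02 : 0 < Re a < 2.
  by rewrite /a (Re_addn w 1); move: w11 => /andP[h1 h2]; lra.
(* Any value strictly between [pi / 2] and [pi] serves: the open sector must contain the lines
   [Im = pi / 2] and [Im = - pi / 2]. *)
pose v : R := pi * (3 / 4).
have p0 : 0 < pi :> R := pi_gt0 R.
have v0pi : 0 < v < pi by rewrite /v; lra.
pose s0 : R := pi / 2.
have sv : `|s0| < v by rewrite ger0_norm /s0 /v; lra.
have sNv : `|- s0| < v by rewrite normrN.
pose q := cexp ('i%C * (a * s0%:C)).
have q0 : q != 0 := cexp_neq0 _.
have rot0 : cintegral setT (fun t => rot a (pt t 0)) = betaK w.
  apply: eq_cintegral => t _; rewrite /rot /pt mulr0 addr0 cexp_real.
  by [].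
have iP : cintegrable setT (fun t => rot a (pt t s0)) := cintegrable_rot v0pi a02 sv.
have iM : cintegrable setT (fun t => rot a (pt t (- s0))) := cintegrable_rot v0pi a02 sNv.
have eP : cintegral setT (fun t => rot a (pt t s0)) = betaK w.
  by rewrite (cintegral_rot v0pi a02 sv).
have eM : cintegral setT (fun t => rot a (pt t (- s0))) = betaK w.
  by rewrite (cintegral_rot v0pi a02 sNv).
have ei t : cexp (pt t s0) = (expR t)%:C * 'i%C.
  by rewrite /pt cexpD cexp_real cexp_ipihalf.
have eNi t : cexp (pt t (- s0)) = (expR t)%:C * - 'i%C.
  rewrite /pt cexpD cexp_real realcN mulrN cexpN cexp_ipihalf; congr (_ * _).
  exact: invi.
have i1 : cintegrable setT (fun t => ce (w + 1) t / (1 + (expR t)%:C ^+ 2) ^+ 2).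
  apply: cintegrable_quadX; rewrite -/a; move: a02 => /andP[h1 h2]; lra.
have i3 : cintegrable setT (fun t => ce (w + 3%:R) t / (1 + (expR t)%:C ^+ 2) ^+ 2).
  apply: cintegrable_quadX; rewrite (Re_addn w 3); move: w11 => /andP[h1 h2]; lra.
have key : (q + q^-1) * betaK w = 2%:R * (quadX (w + 1) - quadX (w + 3%:R)).
  rewrite mulrDl -{1}eM -eP -!cintegralZ // -?cintegralD //; last 2 first.
  - exact: cintegrableZ.
  - exact: cintegrableZ.
  rewrite /quadX -cintegralB // -cintegralZ; last first.
    by apply: cintegrableD => //; exact: cintegrableN.
  apply: eq_cintegral => t _.
  rewrite /rot ei eNi /pt.
  have -> : cexp (a * (t%:C + 'i%C * s0%:C)) = ce a t * q.
    by rewrite mulrDr cexpD /q; congr (_ * cexp _); ring.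
  have -> : cexp (a * (t%:C + 'i%C * (- s0)%:C)) = ce a t / q.
    by rewrite mulrDr cexpD /q -cexpN; congr (_ * cexp _); rewrite realcN; ring.
  have -> : ce (w + 3%:R) t = ce a t * (expR t)%:C ^+ 2.
    by rewrite -ce_nat -ceD /a; congr (ce _ t); ring.
  rewrite -/a.
  have n2 := onePexp2_neq0 t.
  have fac : (1 + (expR t)%:C * 'i%C) * (1 + (expR t)%:C * - 'i%C) = 1 + (expR t)%:C ^+ 2.
    have -> : (expR t)%:C ^+ 2 = - ((expR t)%:C ^+ 2 * 'i%C ^+ 2) :> R[i].
      by rewrite sqr_i mulrN1 opprK.
    ring.
  have nP : 1 + (expR t)%:C * 'i%C != 0 :> R[i].
    by move: n2; rewrite -fac mulf_eq0 negb_or => /andP[].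
  have nM : 1 + (expR t)%:C * - 'i%C != 0 :> R[i].
    by move: n2; rewrite -fac mulf_eq0 negb_or => /andP[].
  have i2 := @sqr_i R.
  rewrite -fac; move: nP nM q0 i2; move: ((expR t)%:C) (ce a t) q 'i%C => e c p j nP nM q0 i2.
  have -> : p * (c / p / (1 + e * - j) ^+ 2) + p^-1 * (c * p / (1 + e * j) ^+ 2) =
     c * ((1 + e * j) ^+ 2 + (1 + e * - j) ^+ 2) / ((1 + e * j) * (1 + e * - j)) ^+ 2.
    by field; rewrite ?nP ?q0 ?nM.
  have -> : (1 + e * j) ^+ 2 + (1 + e * - j) ^+ 2 = 2%:R * (1 - e ^+ 2).
    have -> : e ^+ 2 = - (e ^+ 2 * j ^+ 2) by rewrite i2 mulrN1 opprK.
    ring.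
  ring.
have qE : q + q^-1 = - 2%:R * csin (pi%:C * w / 2%:R).
  have -> : q = 'i%C * cexp ('i%C * (pi%:C * w / 2%:R)).
    rewrite -[X in X * _]cexp_ipihalf -cexpD /q /a; congr cexp.
    by rewrite /s0 realcM realcV natc; field.
  rewrite /csin cexpN; set r := cexp _.
  have r0 : r != 0 := cexp_neq0 _.
  by rewrite invfM invi invfM invi; field.
rewrite qE in key; apply: (mulfI (_ : - 2%:R != 0 :> R[i])).
  by rewrite oppr_eq0 pnatr_eq0.
by rewrite mulrA key; ring.
Qed.

(** The difference of the two integrands has the primitive [exp ((w + 1) t) / (1 + exp (2 t))]. *)
Lemma quadX_ftc w : -1 < Re w < 1 ->
  (w + 1) * quadX (w + 1) = (1 - w) * quadX (w + 3%:R).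
Proof.
move=> w11.
have i1 : cintegrable setT (fun t => ce (w + 1) t / (1 + (expR t)%:C ^+ 2) ^+ 2).
  apply: cintegrable_quadX; rewrite (Re_addn w 1); move: w11 => /andP[h1 h2]; lra.
have i3 : cintegrable setT (fun t => ce (w + 3%:R) t / (1 + (expR t)%:C ^+ 2) ^+ 2).
  apply: cintegrable_quadX; rewrite (Re_addn w 3); move: w11 => /andP[h1 h2]; lra.
apply/eqP; rewrite -subr_eq0 -!cintegralZ // -cintegralB; first last.
- exact: cintegrableZ.
- exact: cintegrableZ.
apply/eqP; apply: (@cintegral_derive _ (fun t => ce (w + 1) t / (1 + (expR t)%:C ^+ 2))).
- move=> t.
  have de : is_cderive (fun t => (expR t)%:C) t (expR t)%:C.
    exact: (is_cderive_real (is_derive_expR t)).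
  have n2 := onePexp2_neq0 t.
  have d2 := is_cderiveV n2 (is_cderiveD (is_cderive_cst 1 t) (is_cderiveM de de)).
  apply: is_cderive_eq (is_cderiveM (is_cderive_ce (w + 1) t) d2) _.
  have -> : ce (w + 3%:R) t = ce (w + 1) t * (expR t)%:C ^+ 2.
    by rewrite -ce_nat -ceD; congr (ce _ t); ring.
  by field.
- by apply: ccontinuousB; apply: ccontinuousM;
    first [exact: ccontinuous_cst|exact: ccontinuous_quadX].
- by apply: cintegrableD; [|apply: cintegrableN]; exact: cintegrableZ.
- apply: (@expdec_kernel _ _ 1 (Re w + 1)).
    by move: w11 => /andP[h1 h2]; lra.
  move=> t; rewrite ComplexField.Normc.normcM ComplexField.Normc.normcV normc_1Dexp2.
  by rewrite normc_ce (Re_addn w 1) mul1r.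
Qed.

Lemma betaK_quadX w : -1 < Re w < 1 -> betaK w = 2%:R * quadX (2%:R * (w + 1)).
Proof.
move=> w11.
have e t : ce (w + 1) (0 + 2 * t) / (1 + (expR (0 + 2 * t))%:C) ^+ 2 =
    ce (2%:R * (w + 1)) t / (1 + (expR t)%:C ^+ 2) ^+ 2.
  rewrite add0r expRM_natl realcX; congr (_ / _).
  by rewrite /ce realcM natc; congr cexp; ring.
rewrite /betaK (@cintegral_affine _ _ 2 0 _ _ _).2 //; first last.
- apply: eq_cintegrable (_ : cintegrable setT
     (fun t => ce (2%:R * (w + 1)) t / (1 + (expR t)%:C ^+ 2) ^+ 2)).
    by move=> t; exact/esym/e.
  apply: cintegrable_quadX; rewrite ReM Re_nat Im_nat mul0r subr0 (Re_addn w 1).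
  by move: w11 => /andP[h1 h2]; lra.
- exact: ccontinuous_betaK.
by rewrite natc; congr (_ * _); apply: eq_cintegral => t _; exact: e.
Qed.

(** Doubling [t] shows that [2 quadX (w + 3)] is [betaK ((w + 1) / 2)] and [2 quadX (w + 1)] is
    [betaK ((w - 1) / 2)]. Of these two terms in the rotation formula, [quadX_ftc] eliminates the
    second here and the first in [betaK_feq2]. *)
Lemma betaK_feq1 w : -1 < Re w < 1 ->
  (w + 1) * (csin (pi%:C * w / 2%:R) * betaK w) = w * betaK ((w + 1) / 2%:R).
Proof.
move=> w11; rewrite betaK_sum_rotations // betaK_quadX; last first.
  rewrite -natc -realcV ReM /= mulr0 subr0 (Re_addn w 1).
  by move: w11 => /andP[h1 h2]; lra.
have -> : 2%:R * ((w + 1) / 2%:R + 1) = w + 3%:R by field.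
rewrite mulrBr quadX_ftc //; ring.
Qed.

Lemma betaK_feq2 w : -1 < Re w < 1 ->
  (1 - w) * (csin (pi%:C * w / 2%:R) * betaK w) = w * betaK ((w - 1) / 2%:R).
Proof.
move=> w11; rewrite betaK_sum_rotations // betaK_quadX; last first.
  rewrite -natc -realcV ReM /= mulr0 subr0 ReD ReN /=.
  by move: w11 => /andP[h1 h2]; lra.
have -> : 2%:R * ((w - 1) / 2%:R + 1) = w + 1 by field.
rewrite mulrBr -quadX_ftc //; ring.
Qed.

(** The value is [2 quadX 3], and [quadX_ftc] at [w = 0] gives [quadX 1 = quadX 3]. Their sum has
    the integrand [exp t / (1 + exp (2 t))], with primitive [atan (exp t)]. *)
Lemma betaK_half : betaK (2%:R^-1) = (pi / 2)%:C.
Proof.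
have w0 : -1 < Re (0 : R[i]) < 1 by rewrite /=; lra.
rewrite betaK_quadX; last by rewrite -natc -realcV /=; lra.
have -> : 2%:R * (2%:R^-1 + 1) = 0 + 3%:R :> R[i] by field.
have := quadX_ftc w0; rewrite subr0 [(0 + 1) * _]mulrC add0r mulr1 mul1r => e.
have -> : 2%:R * quadX (0 + 3%:R) = quadX 1 + quadX (0 + 3%:R) by rewrite e add0r; ring.
rewrite -cintegralD; first last.
- by apply: cintegrable_quadX; rewrite (Re_addn 0 3) /=; lra.
- by apply: cintegrable_quadX; rewrite /=; lra.
have reE t : ce 1 t / (1 + (expR t)%:C ^+ 2) ^+ 2 + ce (0 + 3%:R) t / (1 + (expR t)%:C ^+ 2) ^+ 2
    = (expR t * (1 + expR t ^+ 2)^-1)%:C.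
  rewrite realcM realcV realcD realc1 realcX -ce1 add0r ce_nat -ce1.
  by field; rewrite ce1 onePexp2_neq0.
rewrite (eq_cintegral (G := fun t => (expR t * (1 + expR t ^+ 2)^-1)%:C)) //.
apply: complexP; last by rewrite /= /Rintegral integral0.
rewrite Re_cintegral /= -[RHS]subr0.
have ii : cintegrable setT (fun t => (expR t * (1 + expR t ^+ 2)^-1)%:C).
  apply: eq_cintegrable (cintegrableD (cintegrable_quadX (a := 1) _)
    (cintegrable_quadX (a := 0 + 3%:R) _)); rewrite ?(Re_addn 0 3) /=; [|lra|lra].
  exact: reE.
case: ii => ir _.
apply: (@Rintegral_FTC _ _ (fun t => atan (expR t))) => //.
- move=> t; apply: (is_derive1_eq (is_derive1_comp (is_derive1_atan (expR t)) (is_derive_expR t))).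
  by rewrite mulrC.
- move=> t; apply: cvgM; first exact: continuous_expR.
  apply: cvgV; first by rewrite gt_eqF // addr_gt0 // exprn_gt0 // expR_gt0.
  apply: cvgD; first exact: cvg_cst.
  by apply: cvgM; exact: continuous_expR.
- apply: (cvg_comp _ _ _ (@cvgy_atan R)).
  have : forall t, t <= expR t by move=> t; apply: le_trans (expR_ge1Dx t); rewrite lerDr.
  move=> h; apply: ger_cvgy; last exact: cvg_id.
  by near=> t; exact: h.
- rewrite -(@atan0 R); apply: (continuous_cvg _ (@continuous_atan R 0)).
  apply/cvgNy_compNP.
  exact: cvgr_expR.
Unshelve. all: by end_near. Qed.

End Reflection.

(** * The reflection formula *)

Section ReflectionFormula.
Context {R : realType}.
Implicit Types (z w a : R[i]) (t s : R) (F G : R -> R[i]).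
Local Notation mu := (@lebesgue_measure R).

(** * Limits of complex sequences and the invariant of the functional equations *)

Definition ccvg (u : nat -> R[i]) z :=
  (Re (u k) @[k --> \oo] --> Re z) /\ (Im (u k) @[k --> \oo] --> Im z).

Lemma ccvgM (u v : nat -> R[i]) z w : ccvg u z -> ccvg v w ->
  ccvg (fun k => u k * v k) (z * w).
Proof.
move=> [ur ui] [vr vi]; split.
- by under eq_fun do rewrite ReM; rewrite ReM; apply: cvgB; apply: cvgM.
- by under eq_fun do rewrite ImM; rewrite ImM; apply: cvgD; apply: cvgM.
Qed.

Lemma ccvg_cst z : ccvg (fun=> z) z.
Proof. by split; exact: cvg_cst. Qed.

Lemma ccvg_unique (u : nat -> R[i]) z w : ccvg u z -> ccvg u w -> z = w.
Proof.
move=> [zr zi] [wr wi]; apply: complexP.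
- exact: (cvg_unique (@Rhausdorff R) zr wr).
- exact: (cvg_unique (@Rhausdorff R) zi wi).
Qed.

Lemma ccvg_comp F (u : nat -> R) t : ccontinuous F -> u k @[k --> \oo] --> t ->
  ccvg (fun k => F (u k)) (F t).
Proof.
move=> [cr ci] ut; split; [exact: (cvg_comp _ _ ut (cr t))|exact: (cvg_comp _ _ ut (ci t))].
Qed.

(** The duplication formula, with the cosine written as a shifted sine so that the last factor is
    the sine at the new point [(w + 1) / 2]. *)
Lemma csin_double w :
  csin (pi%:C * w) = 2%:R * csin (pi%:C * w / 2%:R) * csin (pi%:C * ((w + 1) / 2%:R)).
Proof.
have i2 := @sqr_i R.
pose A := cexp ('i%C * (pi%:C * w / 2%:R)).
have A0 : A != 0 := cexp_neq0 _.
have e1 : cexp ('i%C * (pi%:C * w)) = A ^+ 2.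
  by rewrite /A -cexp_natl; congr cexp; field.
have e2 : cexp ('i%C * (pi%:C * ((w + 1) / 2%:R))) = 'i%C * A.
  transitivity (cexp ('i%C * (pi / 2)%:C) * A); last by rewrite cexp_ipihalf.
  rewrite -cexpD; congr cexp.
  by rewrite realcM realcV natc; field.
rewrite /csin !cexpN e1 e2 -/A.
rewrite !invfM invi.
move: A A0 i2 {e1 e2}; move: 'i%C => j A A0 i2.
apply/eqP; rewrite -subr_eq0; apply/eqP.
(* The two sides differ by a multiple of [1 + j ^+ 2], which is 0 at the imaginary unit. *)
transitivity ((1 + j ^+ 2) * ((A ^+ 2 - A ^- 2) * (2%:R^-1 * - j))).
  by field.
by rewrite i2 subrr mul0r.
Qed.

Lemma csinDpi z : csin (z + pi%:C) = - csin z.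
Proof.
have e : cexp ('i%C * pi%:C) = -1 :> R[i].
  rewrite -sqr_i; transitivity (cexp ('i%C * (pi / 2)%:C : R[i]) ^+ 2); last first.
    by rewrite cexp_ipihalf.
  rewrite -cexp_natl; congr cexp.
  by rewrite realcM realcV natc; field.
rewrite /csin mulrDr opprD !cexpD [cexp (- ('i%C * pi%:C))]cexpN e invrN1; ring.
Qed.

(** The steps below express the invariance of [reflS w / w], cross-multiplied since [w] may
    vanish. *)
Definition reflS w := betaK w * csin (pi%:C * w).

Lemma reflS_step1 w : -1 < Re w < 1 ->
  reflS w * ((w + 1) / 2%:R) = w * reflS ((w + 1) / 2%:R).
Proof.
move=> w11; rewrite /reflS csin_double mulrA [RHS]mulrA -betaK_feq1 //; by field.
Qed.

Lemma reflS_step2 w : -1 < Re w < 1 ->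
  reflS w * ((w - 1) / 2%:R) = w * reflS ((w - 1) / 2%:R).
Proof.
move=> w11; rewrite /reflS csin_double [RHS]mulrA -betaK_feq2 //.
have -> : pi%:C * ((w + 1) / 2%:R) = pi%:C * ((w - 1) / 2%:R) + pi%:C.
  by field.
by rewrite csinDpi; field.
Qed.

(** This composes [(w + 1) / 2] with [(w - 1) / 2]. The intermediate point has positive real part,
    so it can be cancelled. *)
Lemma reflS_step w : -1 < Re w < 1 ->
  reflS w * ((w - 1) / 4%:R) = w * reflS ((w - 1) / 4%:R).
Proof.
move=> w11; pose w' := (w + 1) / 2%:R.
have rw' : Re w' = (Re w + 1) / 2.
  by rewrite /w' -natc -realcV ReM /= mulr0 subr0 (Re_addn w 1).
have w'11 : -1 < Re w' < 1 by rewrite rw'; move: w11 => /andP[h1 h2]; lra.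
have w'0 : w' != 0.
  apply/eqP => e; move: rw'; rewrite e /=; move: w11 => /andP[h1 h2]; lra.
have e : (w - 1) / 4%:R = (w' - 1) / 2%:R by rewrite /w'; field.
have h1 := reflS_step1 w11; have h2 := reflS_step2 w'11.
rewrite -/w' in h1; rewrite e; apply: (mulfI w'0).
have -> : w' * (reflS w * ((w' - 1) / 2%:R)) = reflS w * w' * ((w' - 1) / 2%:R) by ring.
rewrite h1 -mulrA h2; ring.
Qed.

(** * Passage to the fixed point *)

Section continuity.
Variable w : R[i].
Hypothesis w11 : -1 < Re w < 1.

(** Around its fixed point the map [(w - 1) / 4] is division by 4, so the iterates of [w] are the
    values of [W] at the powers of [1 / 4], and continuity in a real parameter suffices. *)
Let W s : R[i] := - 3%:R^-1 + (w + 3%:R^-1) * s%:C.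

Let ReW s : Re (W s) = - 3^-1 + (Re w + 3^-1) * s.
Proof. by rewrite /W -natc -realcV !ReImE /=; ring. Qed.

Let dom t (c : R) : 3^-1 <= c <= 1 -> expR (c * t) <= expR (3^-1 * t) + expR (1 * t).
Proof.
move=> /andP[c1 c2]; have [t0|t0] := leP 0 t.
- rewrite -[leLHS]add0r lerD ?expR_ge0 // ler_expR ler_wpM2r //.
- by rewrite -[leLHS]addr0 lerD ?expR_ge0 // ler_expR ler_wnM2r // ltW.
Qed.

(** Since [|Re w + 1 / 3| < 4 / 3], the bound [|s| < 1 / 4] keeps [Re (W s)] within [1 / 3] of
    [- 1 / 3]. The exponents [Re (W s) + 1] then range over a compact part of []0, 2[]. *)
Let near0 s : (`](- 4^-1), 4^-1[%classic s : Prop) ->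
  -1 < Re (W s) < 1 /\ 3^-1 <= Re (W s) + 1 <= 1.
Proof.
rewrite /= in_itv /= -ltr_norml ReW => hs.
have : `|(Re w + 3^-1) * s| <= 3^-1.
  rewrite normrM; apply: (@le_trans _ _ (4 / 3 * 4^-1)); last lra.
  apply: ler_pM => //; last exact: ltW.
  by rewrite ler_norml; move: w11 => /andP[h1 h2]; apply/andP; split; lra.
by rewrite ler_norml => /andP[h1 h2]; split; apply/andP; split; lra.
Qed.

Let ccvg_betaK : ccvg (fun k => betaK (W (4^-1 ^+ k))) (betaK (- 3%:R^-1)).
Proof.
have k1 : 0 < (3^-1 : R) < 2 by lra.
have k2 : 0 < (1 : R) < 2 by rewrite ltr01 ltr1n.
have W0 : W 0 = - 3%:R^-1 by rewrite /W mulr0 addr0.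
rewrite -W0.
have q0 : 4^-1 ^+ k @[k --> \oo] --> (0 : R).
  by apply: cvg_expr; rewrite ger0_norm; lra.
have I0 : (0 : R) \in (`](- 4^-1), 4^-1[%classic : set R).
  by rewrite inE /= in_itv /=; lra.
(* The two extreme exponents dominate all intermediate ones, one on each half-line. *)
pose g t : R := expR (3^-1 * t) / (1 + expR t ^+ 2) + expR (1 * t) / (1 + expR t ^+ 2).
have ig : mu.-integrable setT (EFin \o g).
  exact: (integrableD measurableT (integrable_kernel k1) (integrable_kernel k2)).
have bound s t : (`](- 4^-1), 4^-1[%classic s : Prop) ->
    normc (ce (W s + 1) t / (1 + (expR t)%:C) ^+ 2) <= g t.
  move=> /near0 [_ h]; rewrite (le_trans (betaK_dom _ _)) // mul1r /g -mulrDl.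
  rewrite ler_wpM2r ?dom // invr_ge0 addr_ge0 // exprn_ge0 // expR_ge0 //.
have cW t : ccontinuous (fun s => ce (W s + 1) t / (1 + (expR t)%:C) ^+ 2).
  apply: ccontinuousM; last exact: ccontinuous_cst.
  apply: eq_ccontinuous (ccontinuous_cexp ((1 - 3%:R^-1) * t%:C) ((w + 3%:R^-1) * t%:C)) => s.
  by rewrite /ce /W; congr cexp; ring.
split.
- have cK : Re (betaK (W s)) @[s --> (0 : R)] --> Re (betaK (W 0)).
    apply: (@continuity_under_integral R _ _ mu
      (fun s t => Re (ce (W s + 1) t / (1 + (expR t)%:C) ^+ 2)) setT measurableT
      (- 4^-1) 4^-1 _ _ g ig _ 0 I0).
    + by move=> s /near0 [h _]; case: (cintegrable_betaK h).
    + by apply: aeW => t _ s _; case: (cW t) => + _; exact.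
    + by move=> s hs; apply: aeW => t _; rewrite (le_trans (Re_le_normc _)) // bound.
  exact: (cvg_comp _ _ q0 cK).
- have cK : Im (betaK (W s)) @[s --> (0 : R)] --> Im (betaK (W 0)).
    apply: (@continuity_under_integral R _ _ mu
      (fun s t => Im (ce (W s + 1) t / (1 + (expR t)%:C) ^+ 2)) setT measurableT
      (- 4^-1) 4^-1 _ _ g ig _ 0 I0).
    + by move=> s /near0 [h _]; case: (cintegrable_betaK h).
    + by apply: aeW => t _ s _; case: (cW t) => _; exact.
    + by move=> s hs; apply: aeW => t _; rewrite (le_trans (Im_le_normc _)) // bound.
  exact: (cvg_comp _ _ q0 cK).
Qed.

Lemma reflS_limit : w != 0 -> reflS w * - 3%:R^-1 = w * reflS (- 3%:R^-1).
Proof.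
move=> w0; pose wk k := W (4^-1 ^+ k).
have W0 : W 0 = - 3%:R^-1 by rewrite /W mulr0 addr0.
have wk0 : wk 0%N = w by rewrite /wk /W expr0 mulr1; ring.
have wkS k : wk k.+1 = (wk k - 1) / 4%:R.
  by rewrite /wk /W exprS realcM realcV natc; field.
have rwk k : -1 < Re (wk k) < 1.
  elim: k => [|k ih]; first by rewrite wk0.
  rewrite wkS -natc -realcV ReM /= mulr0 subr0 ReD ReN /=.
  by move: ih => /andP[h1 h2]; lra.
(* An iterate can vanish only if its predecessor is 1, which is outside the strip. *)
have nz k : wk k != 0.
  case: k => [|k]; first by rewrite wk0.
  rewrite wkS mulf_neq0 ?invr_eq0 ?pnatr_eq0 // subr_eq0; apply/eqP => e.
  by move: (rwk k); rewrite e /= ltxx andbF.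
have inv k : reflS w * wk k = w * reflS (wk k).
  elim: k => [|k ih]; first by rewrite wk0 mulrC.
  have := reflS_step (rwk k); rewrite -wkS => h.
  apply: (mulfI (nz k)).
  have -> : wk k * (reflS w * wk k.+1) = reflS w * wk k * wk k.+1 by ring.
  by rewrite ih -mulrA h; ring.
have q0 : 4^-1 ^+ k @[k --> \oo] --> (0 : R).
  by apply: cvg_expr; rewrite ger0_norm; lra.
have cWc : ccontinuous W.
  apply: ccontinuousD; first exact: ccontinuous_cst.
  apply: ccontinuousM; first exact: ccontinuous_cst.
  by apply: ccontinuous_real => t; exact: cvg_id.
have csinc : ccontinuous (fun s => csin (pi%:C * W s)).
  apply: ccontinuousM; last exact: ccontinuous_cst.
  apply: ccontinuousB.
    apply: eq_ccontinuous (ccontinuous_cexp ('i%C * (pi%:C * - 3%:R^-1))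
      ('i%C * (pi%:C * (w + 3%:R^-1)))) => s.
    by rewrite /W; congr cexp; ring.
  apply: eq_ccontinuous (ccontinuous_cexp (- ('i%C * (pi%:C * - 3%:R^-1)))
    (- ('i%C * (pi%:C * (w + 3%:R^-1))))) => s.
  by rewrite /W; congr cexp; ring.
have c1 : ccvg (fun k => reflS w * wk k) (reflS w * - 3%:R^-1).
  apply: ccvgM; first exact: ccvg_cst.
  by rewrite -W0; exact: ccvg_comp.
apply: (ccvg_unique c1).
have -> : (fun k => reflS w * wk k) = (fun k => w * reflS (wk k)) by exact/funext.
apply: ccvgM; first exact: ccvg_cst.
apply: ccvgM; first exact: ccvg_betaK.
by rewrite -W0; exact: (ccvg_comp csinc q0).
Qed.

End continuity.

(** The unknown [reflS (- 1 / 3)] is eliminated between [reflS_limit] at [w] and at [1 / 2]. *)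
Lemma betaK_reflection w : -1 < Re w < 1 ->
  betaK w * csin (pi%:C * w) = pi%:C * w.
Proof.
move=> w11; rewrite -/(reflS w).
have csin0 : csin 0 = 0 :> R[i] by rewrite /csin mulr0 oppr0 subrr mul0r.
have [->|w0] := eqVneq w 0; first by rewrite /reflS mulr0 csin0 mulr0.
have h2 : -1 < Re (2%:R^-1 : R[i]) < 1 by rewrite -natc -realcV /=; lra.
have n2 : 2%:R^-1 != 0 :> R[i] by rewrite invr_eq0 pnatr_eq0.
have e2 : reflS (2%:R^-1 : R[i]) = pi%:C / 2%:R.
  rewrite /reflS betaK_half /csin.
  have -> : 'i%C * (pi%:C * 2%:R^-1) = 'i%C * (pi / 2)%:C :> R[i].
    by rewrite realcM realcV natc.
  rewrite cexpN cexp_ipihalf.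
  by rewrite invi realcM realcV natc; field; exact: i_neq0.
have l1 := reflS_limit w11 w0; have l2 := reflS_limit h2 n2.
rewrite e2 in l2.
have n3 : - 3%:R^-1 != 0 :> R[i] by rewrite oppr_eq0 invr_eq0 pnatr_eq0.
apply: (mulIf n3); apply: (mulfI n2); rewrite l1 mulrCA -l2; by field.
Qed.

End ReflectionFormula.

(** * The Gamma function *)

Section GammaFunction.
Context {R : realType}.
Implicit Types (z w a : R[i]) (t s : R) (F G : R -> R[i]) (f g : R -> R).
Local Notation mu := (@lebesgue_measure R).

Lemma clog_pos t : 0 < t -> clog (t%:C) = (ln t)%:C :> R[i].
Proof.
move=> t0; rewrite /clog /carg normc_real gtr0_norm // lexx.
by rewrite [Re _]/= divff ?gt_eqF // acos1.
Qed.

Lemma cpow_pos t z : 0 < t -> cpow t%:C z = ce z (ln t).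
Proof.
by move=> t0; rewrite /cpow (negbTE (real_gt0_neq0 t0)) clog_pos.
Qed.

(** Agreement is asked on the positive axis only, [ln] having default values elsewhere; [F] inherits
    continuity at [u > 0] because the agreement holds near [u]. *)
Lemma cintegral_ln F G : ccontinuous G -> (forall u : R, 0 < u -> F u = G (ln u)) ->
  cintegrable setT (fun t => G t * (expR t)%:C) ->
  cintegrable `]0, +oo[ F /\
  cintegral `]0, +oo[ F = cintegral setT (fun t => G t * (expR t)%:C).
Proof.
move=> [cr ci] FG iG.
have FE t : F (expR t) = G t by rewrite FG ?expR_gt0 // expRK.
have -> : (fun t => G t * (expR t)%:C) = (fun t => F (expR t) * (expR t)%:C).
  by apply/funext => t; rewrite FE.
have nr (h : R[i] -> R) (u : R) : 0 < u -> continuous (fun t => h (G t)) ->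
    {for u, continuous (fun u : R => h (F u))}.
  move=> u0 ch; rewrite /prop_for /continuous_at FG //.
  have cl : (fun u : R => h (G (ln u))) x @[x --> u] --> h (G (ln u)).
    exact: (cvg_comp _ _ (continuous_ln u0) (ch (ln u))).
  apply: cvg_trans cl; apply: near_eq_cvg.
  by near=> x; rewrite FG //; near: x; exact: lt_nbhsr.
apply: cintegral_expR => [u u0|u u0|].
- exact: (nr (@complex.Re R)).
- exact: (nr (@complex.Im R)).
- by apply: eq_cintegrable iG => t; rewrite FE.
Unshelve. all: by end_near. Qed.

Lemma ccontinuous_comp F (h : R -> R) : continuous h -> ccontinuous F ->
  ccontinuous (fun t => F (h t)).
Proof.
move=> ch [cr ci]; split => t.
- exact: (cvg_comp _ _ (ch t) (cr (h t))).
- exact: (cvg_comp _ _ (ch t) (ci (h t))).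
Qed.

(* Euler's integrand [u ^ (z - 1) * exp (- u) du], with [u = exp t] *)
Definition gker z t : R[i] := ce z t * (expR (- expR t))%:C.

Lemma is_cderive_gker z t : is_cderive (gker z) t (z * gker z t - gker (z + 1) t).
Proof.
have d1 : is_derive t 1 (fun s : R => expR (- expR s)) (- expR t * expR (- expR t)).
  by apply: is_derive_eq; rewrite /GRing.scale /=; ring.
apply: is_cderive_eq (is_cderiveM (is_cderive_ce z t) (is_cderive_real d1)) _.
by rewrite /gker ceD ce1 realcM realcN; ring.
Qed.

Lemma ccontinuous_gker z : ccontinuous (gker z).
Proof. by apply: is_cderive_continuous => t; exact: is_cderive_gker. Qed.

Lemma normc_gker z t : normc (gker z t) = expR (Re z * t) * expR (- expR t).
Proof.
by rewrite ComplexField.Normc.normcM normc_ce normc_real ger0_norm // expR_ge0.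
Qed.

(** At minus infinity [exp (Re z t)] decays; at plus infinity [exp (- exp t) <= k! exp (- k t)] for
    an integer [k > Re z]. *)
Lemma expdec_gker z : 0 < Re z -> expdec (gker z).
Proof.
move=> z0; pose n := Num.truncn (Re z); pose k := n.+1.
have kz : Re z < k%:R by rewrite truncnS_gt.
apply: (@expdecI _ _ 1 k`!%:R (Re z) (k%:R - Re z)); rewrite ?subr_gt0 //.
- move=> t; by rewrite normc_gker mul1r ler_piMr ?expR_ge0 // -expR0 ler_expR oppr_le0.
- move=> t; rewrite normc_gker expRN.
  have f0 : 0 < k`!%:R :> R by rewrite ltr0n fact_gt0.
  rewrite ler_pdivrMr ?expR_gt0 //.
  have h : expR t ^+ k / k`!%:R <= expR (expR t).
    by apply: le_trans (expR_ge1Dxn n (expR_ge0 t)); rewrite lerDr.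
  have -> : expR (Re z * t) = k`!%:R * expR (- ((k%:R - Re z) * t)) * (expR t ^+ k / k`!%:R).
    transitivity (expR (- ((k%:R - Re z) * t)) * expR (k%:R * t)).
      by rewrite -expRD; congr expR; ring.
    by rewrite expRM_natl; field; exact: lt0r_neq0.
  rewrite ler_wpM2l // mulr_ge0 ?expR_ge0 // ltW //.
Qed.

Lemma cintegrable_gker z : 0 < Re z -> cintegrable setT (gker z).
Proof.
by move=> z0; apply: cintegrable_expdec; [exact: ccontinuous_gker|exact: expdec_gker].
Qed.

(** For positive real part [gamma_shift] is 0 and [Gamma] is Euler's integral itself; all arguments
    in the theorem are of this kind. *)
Lemma Gamma_gker z : 0 < Re z -> Gamma z = cintegral setT (gker z).
Proof.
move=> z0; rewrite /Gamma /gamma_shift z0 big_ord0 divr1 addr0 /gamma_integral.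
pose G t := ce (z - 1) t * (expR (- expR t))%:C.
have GE t : G t * (expR t)%:C = gker z t.
  have -> : gker z t = ce (z - 1 + 1) t * (expR (- expR t))%:C by rewrite subrK.
  by rewrite ceD ce1 /G; ring.
have [|||_ ->] := @cintegral_ln (fun t => cpow t%:C (z - 1) * (expR (- t))%:C) G.
- apply: ccontinuousM; first exact: ccontinuous_ce.
  apply: ccontinuous_real => t; apply: (@continuous_comp _ _ _ (fun t => - expR t) expR).
    by apply: cvgN; exact: continuous_expR.
  exact: continuous_expR.
- by move=> u u0; rewrite cpow_pos // /G lnK.
- by apply: eq_cintegrable (cintegrable_gker z0) => t; rewrite GE.
- by apply: eq_cintegral => t _; rewrite GE.
Qed.

(** The combination [z * gker z - gker (z + 1)] is the derivative of [gker z]. *)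
Lemma GammaS z : 0 < Re z -> Gamma (z + 1) = z * Gamma z.
Proof.
move=> z0; have z1 : 0 < Re (z + 1) by rewrite (Re_addn z 1) addr_gt0.
rewrite !Gamma_gker //.
have i0 := cintegrable_gker z0; have i1 := cintegrable_gker z1.
have h : cintegral setT (fun t => z * gker z t - gker (z + 1) t) = 0.
  apply: (@cintegral_derive _ (gker z)).
  - by move=> t; exact: is_cderive_gker.
  - apply: ccontinuousB; last exact: ccontinuous_gker.
    by apply: ccontinuousM; [exact: ccontinuous_cst|exact: ccontinuous_gker].
  - by apply: cintegrableD; [exact: cintegrableZ|exact: cintegrableN].
  - exact: expdec_gker.
move: h; rewrite cintegralB //; last exact: cintegrableZ.
by rewrite cintegralZ // => /eqP; rewrite subr_eq0 => /eqP.
Qed.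

Lemma cvg_expR_Ny : @expR R t @[t --> -oo] --> 0.
Proof. by apply/cvgNy_compNP; exact: cvgr_expR. Qed.

Lemma cvg_expR_y : @expR R t @[t --> +oo] --> +oo.
Proof.
have h (t : R) : t <= expR t by apply: le_trans (expR_ge1Dx t); rewrite lerDr.
by apply: ger_cvgy; [near=> t; exact: h|exact: cvg_id].
Unshelve. all: by end_near. Qed.

Lemma Gamma1 : Gamma 1 = 1 :> R[i].
Proof.
have i1 : cintegrable setT (gker 1) by apply: cintegrable_gker => /=.
rewrite Gamma_gker //=.
have gE t : gker 1 t = (expR t * expR (- expR t))%:C by rewrite /gker ce1 realcM.
rewrite (eq_cintegral (G := fun t => (expR t * expR (- expR t))%:C)) //.
apply: complexP; last by rewrite Im_cintegral /= /Rintegral integral0.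
rewrite Re_cintegral /=.
have -> : 1 = 0 - (-1) :> R by rewrite sub0r opprK.
have [ir _] := i1.
apply: (@Rintegral_FTC _ _ (fun t => - expR (- expR t))).
- by move=> t; apply: is_derive_eq; rewrite /GRing.scale /=; ring.
- move=> t; apply: cvgM; first exact: continuous_expR.
  apply: (@continuous_comp _ _ _ (fun t => - expR t) expR).
    by apply: cvgN; exact: continuous_expR.
  exact: continuous_expR.
- by apply: (eq_integrable measurableT _ _ _ ir) => t _; rewrite gE.
- rewrite -[X in _ --> X]oppr0; apply: cvgN.
  exact: (cvg_comp _ _ cvg_expR_y (@cvgr_expR R)).
- apply: cvgN; have -> : 1 = expR (- 0) :> R by rewrite oppr0 expR0.
  have c0 : - expR t @[t --> -oo] --> (- 0 : R) by apply: cvgN; exact: cvg_expR_Ny.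
  by apply: (cvg_comp _ _ c0); exact: continuous_expR.
Qed.

Lemma Gamma_nat n : Gamma (n%:R + 1) = n`!%:R :> R[i].
Proof.
elim: n => [|n ih]; first by rewrite add0r Gamma1 fact0.
have -> : n.+1%:R = n%:R + 1 :> R[i] by rewrite -natr1.
rewrite GammaS ?ih; last by rewrite (Re_addn _ 1) Re_nat ltr_wpDl // ler0n.
by rewrite natr1 factS natrM.
Qed.

Lemma Gamma_addn n z : -1 < Re z ->
  Gamma (n%:R + z + 1) = (\prod_(k < n) (k.+1%:R + z)) * Gamma (1 + z).
Proof.
move=> z1; elim: n => [|n ih]; first by rewrite big_ord0 mul1r add0r addrC.
have -> : n.+1%:R + z + 1 = (n%:R + z + 1) + 1 by rewrite -natr1; ring.
rewrite GammaS ?ih; last first.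
  rewrite (Re_addn _ 1) ReD Re_nat -addrA ltr_wpDl ?ler0n //.
  by rewrite -ltrBlDr sub0r.
rewrite big_ord_recr /= mulrA; congr (_ * _); rewrite mulrC; congr (_ * _).
by rewrite -natr1; ring.
Qed.

(** Fubini and translation invariance in [v]; integrability on the product comes from Tonelli, where
    the iterated integral of absolute values factors. Slices are assumed integrable for every [v],
    where Fubini gives almost every [v], so that inner integrals can be compared pointwise. *)
Lemma Rconvolution f g : continuous f -> continuous g ->
  mu.-integrable setT (EFin \o f) -> mu.-integrable setT (EFin \o g) ->
  (forall v, mu.-integrable setT (fun s => (f (s + v) * g s)%:E)) ->
  mu.-integrable setT (fun v => (\int[mu]_s (f (s + v) * g s))%:E) /\
  \int[mu]_v \int[mu]_s (f (s + v) * g s) = (\int[mu]_t f t) * (\int[mu]_t g t).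
Proof.
move=> cf cg intf intg intH.
pose H (p : measurableTypeR R * measurableTypeR R) : \bar R := (f (p.2 + p.1) * g p.2)%:E.
have mf : measurable_fun setT f by exact: continuous_measurable_fun.
have mg : measurable_fun setT g by exact: continuous_measurable_fun.
have mH : measurable_fun setT H.
  apply/measurable_EFinP; apply: measurable_funM.
    apply: (measurableT_comp mf).
    by apply: measurable_funD; [exact: measurable_snd|exact: measurable_fst].
  by apply: (measurableT_comp mg); exact: measurable_snd.
have trans (h : R -> R) s : continuous h -> mu.-integrable setT (EFin \o h) ->
    mu.-integrable setT (fun v => (h (s + v))%:E) /\
    \int[mu]_v h (s + v) = \int[mu]_t h t.
  move=> ch ih.
  have [] := @Rintegral_affine R (fun v => h (s + v)) 1 (- s) ltr01.
  - move=> v; apply: (@continuous_comp _ _ _ (fun v => s + v) h); last exact: ch.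
    by apply: cvgD; [exact: cvg_cst|exact: cvg_id].
  - by apply: (eq_integrable measurableT _ _ _ ih) => v _ /=; rewrite mulr1 mul1r addrA subrr add0r.
  - by move=> h1 ->; split => //; apply: eq_Rintegral => v _; rewrite mulr1 mul1r addrA subrr add0r.
have iH : (mu \x mu)%E.-integrable setT H.
  apply/integrable21ltyP => //.
  have nf : mu.-integrable setT (EFin \o (fun t => `|f t|)) := integrable_abse intf.
  have cnf : continuous (fun t => `|f t|) by move=> t; apply: cvg_norm; exact: cf.
  have e s : (\int[mu]_v `|H (v, s)| = (`|g s| * \int[mu]_t `|f t|)%:E)%E.
    have [i1 e1] := trans _ s cnf nf.
    rewrite -e1 mulrC -RintegralZr // /Rintegral fineK.
      by apply: eq_integral => v _; rewrite /H /= normrM.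
    by apply: integrable_fin_num => //; exact: (integrableZr measurableT `|g s| i1).
  under eq_integral => s _ do rewrite e.
  have ng : mu.-integrable setT (EFin \o (fun t => `|g t|)) := integrable_abse intg.
  have := integrableZr measurableT (\int[mu]_t `|f t|)%R ng.
  by move=> /integrable_lty; apply.
have FH := @Fubini _ _ _ _ _ mu mu H iH.
have inner s : (\int[mu]_v H (v, s) = (g s * \int[mu]_t f t)%:E)%E.
  have [i1 e1] := trans _ s cf intf.
  rewrite -e1 mulrC -RintegralZr // /Rintegral fineK //.
  by apply: integrable_fin_num => //; exact: (integrableZr measurableT (g s) i1).
have outer v : (\int[mu]_s H (v, s) = (\int[mu]_s (f (s + v) * g s))%:E)%E.
  by rewrite /Rintegral fineK //; apply: integrable_fin_num.
have iG : mu.-integrable setT (fun v => (\int[mu]_s (f (s + v) * g s))%:E).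
  apply: (eq_integrable measurableT _ _ _ (integrable_fubini_F iH)) => v _.
  by rewrite -outer.
split => //.
rewrite mulrC -RintegralZr // {1}/Rintegral [RHS]/Rintegral; congr fine.
transitivity (\int[mu]_v \int[mu]_s H (v, s))%E; first by apply: eq_integral => v _; rewrite outer.
by rewrite FH; apply: eq_integral => s _; rewrite inner.
Qed.

Lemma expdec_bounded F : expdec F -> exists A, forall t, normc (F t) <= A.
Proof.
move=> [A [a [a0 h]]]; exists `|A| => t; apply: (le_trans (h t)).
apply: (@le_trans _ _ (`|A| * expR (- (a * `|t|)))).
  by rewrite ler_wpM2r ?expR_ge0 // ler_norm.
by rewrite ler_piMr // expR_le1 oppr_le0 mulr_ge0 // ltW.
Qed.

(** The product expands into four real convolutions, whose slices are integrable because [F] is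
    bounded. *)
Lemma cconvolution F G : ccontinuous F -> expdec F -> ccontinuous G -> expdec G ->
  cintegral setT (fun v => cintegral setT (fun s => F (s + v) * G s)) =
  cintegral setT F * cintegral setT G.
Proof.
move=> cF eF cG eG.
have [iFr iFi] := cintegrable_expdec cF eF.
have [iGr iGi] := cintegrable_expdec cG eG.
have [B hB] := expdec_bounded eF.
have [cFr cFi] := cF; have [cGr cGi] := cG.
have inner (f g : R -> R) : continuous f -> continuous g ->
    (forall t, `|f t| <= normc (F t)) -> mu.-integrable setT (EFin \o g) ->
    forall v, mu.-integrable setT (fun s => (f (s + v) * g s)%:E).
  move=> cf cg fF ig v.
  have iBg := integrableZl measurableT B ig.
  apply: (le_integrable measurableT _ _ iBg).
    apply/measurable_EFinP; apply: continuous_measurable_fun => s.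
    apply: cvgM; last exact: cg.
    apply: (@continuous_comp _ _ _ (fun s => s + v) f); last exact: cf.
    by apply: cvgD; [exact: cvg_id|exact: cvg_cst].
  move=> s _; rewrite /= lee_fin !normrM ler_wpM2r //.
  by rewrite (le_trans (fF _)) // (le_trans (hB _)) // ler_norm.
have rF t := Re_le_normc (F t); have mF t := Im_le_normc (F t).
have jrr := inner _ _ cFr cGr rF iGr; have jii := inner _ _ cFi cGi mF iGi.
have jri := inner _ _ cFr cGi rF iGi; have jir := inner _ _ cFi cGr mF iGr.
have [krr err] := Rconvolution cFr cGr iFr iGr jrr.
have [kii eii] := Rconvolution cFi cGi iFi iGi jii.
have [kri eri] := Rconvolution cFr cGi iFr iGi jri.
have [kir eir] := Rconvolution cFi cGr iFi iGr jir.
apply: complexP; rewrite ?ReM ?ImM !Re_cintegral !Im_cintegral.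
- rewrite -err -eii -RintegralB //; apply: eq_Rintegral => v _.
  rewrite Re_cintegral -RintegralB; [|exact: measurableT|exact: jrr|exact: jii].
  by apply: eq_Rintegral => s _; rewrite ReM.
- rewrite -eri -eir -RintegralD //; apply: eq_Rintegral => v _.
  rewrite Im_cintegral -RintegralD; [|exact: measurableT|exact: jri|exact: jir].
  by apply: eq_Rintegral => s _; rewrite ImM.
Qed.

Lemma Gamma2 : cintegral setT (gker 2%:R) = 1.
Proof.
rewrite -Gamma_gker ?Re_nat ?ltr0n //.
by rewrite -[2%:R]/(1%:R + 1 : R[i]) Gamma_nat.
Qed.

(** In logarithmic variables the product is a convolution. For fixed [v] the powers of [exp s]
    combine into [exp (2 s)] and the exponentials into [exp (- A exp s)] with [A = 1 + exp v];
    translating [s] by [ln A] leaves [Gamma 2 = 1] times [exp ((1 + z) v) / A ^ 2], the integrand of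
    [betaK z]. *)
Lemma Gamma_reflection z : -1 < Re z < 1 -> Gamma (1 + z) * Gamma (1 - z) = betaK z.
Proof.
move=> /andP[z1 z2].
have p1 : 0 < Re (1 + z) by rewrite ReD /= -ltrBlDl sub0r.
have p2 : 0 < Re (1 - z) by rewrite ReD ReN /= subr_gt0.
rewrite !Gamma_gker // -cconvolution;
  try exact: ccontinuous_gker; try exact: expdec_gker.
apply: eq_cintegral => v _.
pose A := 1 + expR v; have A0 : 0 < A by rewrite addr_gt0 // expR_gt0.
pose H s : R[i] := gker 2%:R (ln A + 1 * s).
have HE s : gker (1 + z) (s + v) * gker (1 - z) s = (ce (1 + z) v / A%:C ^+ 2) * H s.
  rewrite /H /gker mul1r !ce_addt.
  have -> : ce 2%:R (ln A) = A%:C ^+ 2 by rewrite ce_nat lnK.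
  have -> : ce 2%:R s = ce (1 + z) s * ce (1 - z) s.
    by rewrite -ceD; congr (ce _ s); ring.
  have -> : expR (- expR (ln A + s)) = expR (- expR (s + v)) * expR (- expR s).
    rewrite -expRD; congr expR; rewrite !expRD lnK // /A; ring.
  by rewrite realcM; field; exact: real_gt0_neq0.
have H1 : cintegrable setT H.
  have e2 : expdec H.
    have [B [b [b0 h]]] := expdec_gker (z := 2%:R) (ltac:(by rewrite Re_nat ltr0n)).
    (* The translation costs a constant factor, because [|t| <= |ln A + t| + |ln A|]. *)
    exists (`|B| * expR (b * `|ln A|)), b; split => // t.
    apply: (le_trans (h _)); apply: (@le_trans _ _ (`|B| * expR (- (b * `|ln A + 1 * t|)))).
      by rewrite ler_wpM2r ?expR_ge0 // ler_norm.
    rewrite -mulrA ler_wpM2l // -expRD ler_expR mul1r -mulrN -mulrN -mulrDr ler_wpM2l ?(ltW b0) //.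
    by have := ler_normB (ln A + t) (ln A); rewrite addrAC subrr add0r; lra.
  apply: cintegrable_expdec => //.
  apply: (ccontinuous_comp (F := gker 2%:R)); last exact: ccontinuous_gker.
  move=> t; apply: cvgD; first exact: cvg_cst.
  by apply: cvgM; [exact: cvg_cst|exact: cvg_id].
rewrite (eq_cintegral (G := fun s => ce (1 + z) v / A%:C ^+ 2 * H s)) => [|s _]; last exact: HE.
rewrite cintegralZ //.
have [_] := @cintegral_affine _ (gker 2%:R) 1 (ln A) ltr01 (ccontinuous_gker _) H1.
rewrite Gamma2 mul1r => <-; rewrite mulr1 /A realcD [1 + z]addrC.
by [].
Qed.

End GammaFunction.

(** * Finite differences *)

Section FiniteDifferences.
Variable K : fieldType.
Implicit Types (h : nat -> K) (y z : K).

(** The [N]-th iterated difference at 0, with the sign for which one step is [h i - h i.+1]. *)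
Definition altsum (N : nat) h : K := \sum_(i < N.+1) (-1) ^+ i * 'C(N, i)%:R * h i.

Lemma altsumS N h : altsum N.+1 h = altsum N (fun i => h i - h i.+1).
Proof.
rewrite /altsum big_ord_recl /= bin0 expr0 !mul1r.
under eq_bigr => i _ do rewrite /bump /= add1n binS natrD exprS mulrDr mulrDl.
rewrite big_split /= addrA.
have -> : h 0%N + \sum_(i < N.+1) -1 * (-1) ^+ i * 'C(N, i.+1)%:R * h i.+1 =
    \sum_(i < N.+1) (-1) ^+ i * 'C(N, i)%:R * h i.
  transitivity (\sum_(i < N.+2) (-1) ^+ i * 'C(N, i)%:R * h i).
    rewrite [RHS]big_ord_recl /= bin0 expr0 !mul1r; congr (_ + _).
    by apply: eq_bigr => i _; rewrite /bump /= add1n exprS.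
  by rewrite big_ord_recr /= bin_small // mulr0 mul0r addr0.
rewrite -big_split /=; apply: eq_bigr => i _; ring.
Qed.

Lemma altsum_sum N (r : nat) (h : nat -> nat -> K) (c : nat -> K) :
  altsum N (fun i => \sum_(k < r) c k * h k i) = \sum_(k < r) c k * altsum N (h k).
Proof.
rewrite /altsum; under eq_bigr => i _ do rewrite mulr_sumr.
rewrite exchange_big /=; apply: eq_bigr => k _.
by rewrite mulr_sumr; apply: eq_bigr => i _; rewrite mulrCA.
Qed.

Lemma eq_altsum N h1 h2 : h1 =1 h2 -> altsum N h1 = altsum N h2.
Proof. by move=> e; apply: eq_bigr => i _; rewrite e. Qed.

(** One difference turns the power [r] into a combination of lower powers based at [y - 1]. *)
Lemma altsum_pow N r y : (r < N)%N -> altsum N (fun i => (y - i%:R) ^+ r) = 0.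
Proof.
elim: N r y => // N ih r y rN; rewrite altsumS.
rewrite (@eq_altsum _ _ (fun i => \sum_(k < r) 'C(r, k)%:R * (y - 1 - i%:R) ^+ k)).
  rewrite (@altsum_sum N r (fun k i => (y - 1 - i%:R) ^+ k) (fun k => 'C(r, k)%:R)).
  rewrite big1 // => k _; rewrite ih ?mulr0 //.
  by rewrite (leq_trans (ltn_ord k)).
move=> i; have -> : y - i%:R = 1 + (y - 1 - i%:R) by ring.
have -> : y - i.+1%:R = y - 1 - i%:R by rewrite -natr1; ring.
rewrite exprDn big_ord_recr /= subnn expr0 mul1r binn mulr1n addrK.
by apply: eq_bigr => k _; rewrite expr1n mul1r mulr_natl.
Qed.

(** In the inductive step the sums at [z] and [z + 1] are subtracted. The product of [N + 2] factors
    is split at its last factor for the one and at its first for the other, and these two factors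
    differ by [N + 1]. *)
Lemma altsum_inv N z : (forall i, (i <= N)%N -> z + i%:R != 0) ->
  altsum N (fun i => (z + i%:R)^-1) * \prod_(i < N.+1) (z + i%:R) = N`!%:R.
Proof.
elim: N z => [|N ih] z z0.
  rewrite /altsum !big_ord_recl !big_ord0 /= expr0 bin0 !mul1r addr0 mulr1 mulVf //.
  exact: z0.
rewrite altsumS.
have e : altsum N (fun i => (z + i%:R)^-1 - (z + i.+1%:R)^-1) =
    altsum N (fun i => (z + i%:R)^-1) - altsum N (fun i => (z + 1 + i%:R)^-1).
  rewrite /altsum -sumrB; apply: eq_bigr => i _.
  by rewrite mulrBr -natr1 [i%:R + 1]addrC addrA.
rewrite e mulrBl.
have z1 i : (i <= N)%N -> z + 1 + i%:R != 0.
  by move=> iN; rewrite -addrA nat1r; exact: z0.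
have P1 : \prod_(i < N.+2) (z + i%:R) = \prod_(i < N.+1) (z + i%:R) * (z + N.+1%:R).
  by rewrite big_ord_recr.
have P2 : \prod_(i < N.+2) (z + i%:R) = \prod_(i < N.+1) (z + 1 + i%:R) * z.
  rewrite big_ord_recl /= addr0 mulrC; congr (_ * _); apply: eq_bigr => i _.
  by rewrite /bump /= -addrA nat1r.
rewrite {1}P1 P2 !mulrA ih; last by move=> i iN; apply: z0; rewrite (leq_trans iN).
rewrite ih // factS natrM; ring.
Qed.

(** The factors run from [y - n] to [y + a]. Grouped around [y], they are the products by which the
    Gamma factors differ from [Gamma (1 - y)] and [Gamma (1 + y)]. *)
Lemma prod_shift n a y :
  \prod_(i < (n + a).+1) (y - n%:R + i%:R) =
  (-1) ^+ n * \prod_(k < n) (k.+1%:R - y) * y * \prod_(k < a) (k.+1%:R + y).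
Proof.
elim: n => [|n ih].
  rewrite add0n subr0 big_ord0 expr0 !mul1r big_ord_recl /= addr0; congr (_ * _).
  by apply: eq_bigr => i _; rewrite /bump /= addrC.
rewrite addSn big_ord_recl /= addr0.
have e i : y - n.+1%:R + i.+1%:R = y - n%:R + i%:R by rewrite -!natr1; ring.
under eq_bigr => i _ do rewrite /bump /= add1n e.
rewrite ih big_ord_recr /= exprS; ring.
Qed.

End FiniteDifferences.

(** * Mellin transforms of partial fractions *)

Section MellinTransform.
Context {R : realType}.
Implicit Types (z w p : R[i]) (t s : R).
Local Notation mu := (@lebesgue_measure R).

Variables (n N : nat).
Hypothesis N_gt0 : (0 < N)%N.

(** The sign is a product of natural powers, as [n - i] may be negative. *)
Definition coef (i : nat) : R[i] := (-1) ^+ n * ((-1) ^+ i * 'C(N, i)%:R).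
Definition lam (i : nat) : R := (n%:R - i%:R) ^+ 2.
Local Notation c := coef.

Lemma lam_ge0 i : 0 <= lam i. Proof. exact: sqr_ge0. Qed.
Local Hint Resolve lam_ge0 : core.

Lemma den_gt0 i s : 0 < expR s + lam i.
Proof. by rewrite ltr_wpDr // expR_gt0. Qed.
Local Hint Resolve den_gt0 : core.

Definition den i s : R[i] := (expR s)%:C + (lam i)%:C.

Lemma den_neq0 i s : den i s != 0.
Proof. by rewrite /den -realcD; exact: real_gt0_neq0. Qed.

Lemma moment_eq0 j : (2 * j < N)%N -> \sum_(i < N.+1) c i * (lam i)%:C ^+ j = 0.
Proof.
move=> jN.
transitivity ((-1) ^+ n * altsum N (fun i => (n%:R - i%:R : R[i]) ^+ (2 * j))).
  rewrite /altsum mulr_sumr; apply: eq_bigr => i _.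
  by rewrite /coef /lam realcX -exprM realcD realcN !natc !mulrA.
by rewrite altsum_pow // mulr0.
Qed.

(** With [exp s = x ^ 2], this is the partial fraction sum multiplied by [x ^ (2 j)], up to sign.
    The exponent [j.+1] makes the term [i = n], where [lam i = 0], vanish. *)
Definition Qsum (j : nat) s : R[i] := \sum_(i < N.+1) c i * (lam i)%:C ^+ j.+1 / den i s.

Lemma sum_Qsum0 s :
  \sum_(i < N.+1) c i * ((expR s)%:C / den i s) = - Qsum 0 s.
Proof.
apply/eqP; rewrite -subr_eq0 opprK /Qsum -big_split /=; apply/eqP.
rewrite -[RHS](@moment_eq0 0) ?muln0 //; apply: eq_bigr => i _.
have := den_neq0 i s; rewrite /den => d0; rewrite expr1 expr0; field.
by [].
Qed.

(** Writing [u / (u + lam) = 1 - lam / (u + lam)] with [u = exp s], the polynomial part is the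
    moment of order [j.+1], which vanishes. *)
Lemma QsumS j s : (2 * j.+1 < N)%N -> (expR s)%:C * Qsum j s = - Qsum j.+1 s.
Proof.
move=> jN; apply/eqP; rewrite -subr_eq0 opprK /Qsum mulr_sumr -big_split /=; apply/eqP.
rewrite -[RHS](moment_eq0 jN); apply: eq_bigr => i _.
have := den_neq0 i s; rewrite /den => d0; rewrite !exprS; field.
by [].
Qed.

Lemma Qsum_expR j s : (2 * j < N)%N -> (expR s)%:C ^+ j * Qsum 0 s = (-1) ^+ j * Qsum j s.
Proof.
elim: j => [|j ih] jN; first by rewrite !expr0.
have jN' : (2 * j < N)%N by rewrite (leq_trans _ jN) // ltnS leq_mul2l leqnSn orbT.
by rewrite exprS -mulrA ih // mulrCA QsumS // exprS; ring.
Qed.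

Lemma normc_den i s : normc (den i s) = expR s + lam i.
Proof. by rewrite /den -realcD normc_real gtr0_norm. Qed.

Lemma Qsum_bound_y j : exists A, forall s, normc (Qsum j s) <= A * expR (- s).
Proof.
exists (\sum_(i < N.+1) normc (c i * (lam i)%:C ^+ j.+1)) => s.
rewrite (le_trans (le_normc_sum _ _ _)) // mulr_suml; apply: ler_sum => i _.
rewrite ComplexField.Normc.normcM ler_wpM2l ?normc_ge0 //.
rewrite ComplexField.Normc.normcV normc_den expRN lef_pV2 ?posrE ?expR_gt0 //.
by rewrite lerDl.
Qed.

Lemma Qsum_bound j : exists A, forall s, normc (Qsum j s) <= A.
Proof.
exists (\sum_(i < N.+1) normc (c i * (lam i)%:C ^+ j)) => s.
rewrite (le_trans (le_normc_sum _ _ _)) //; apply: ler_sum => i _.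
rewrite exprSr mulrA -mulrA ComplexField.Normc.normcM ler_piMr ?normc_ge0 //.
rewrite ComplexField.Normc.normcM ComplexField.Normc.normcV normc_den normc_real ger0_norm //.
by rewrite ler_pdivrMr // mul1r lerDr expR_ge0.
Qed.

Lemma ccontinuous_den i : ccontinuous (den i).
Proof.
apply: ccontinuousD; last exact: ccontinuous_cst.
by apply: ccontinuous_real; exact: continuous_expR.
Qed.

Lemma ccontinuous_Qsum j : ccontinuous (Qsum j).
Proof.
apply: ccontinuous_sum => i _; apply: ccontinuousM; first exact: ccontinuous_cst.
by apply: ccontinuousV; [move=> s; exact: den_neq0|exact: ccontinuous_den].
Qed.

(** The terms left when the derivative falls on [1 / den i]. Unlike those of [Qsum], they are
    integrable one by one even if [Re w = 0]. *)
Definition Tterm (j : nat) w (i : nat) s : R[i] :=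
  c i * (lam i)%:C ^+ j.+1 * (ce (w + 1) s / den i s ^+ 2).

Lemma is_cderive_Qsum j w s :
  is_cderive (fun s => ce w s * Qsum j s) s
    (w * (ce w s * Qsum j s) - \sum_(i < N.+1) Tterm j w i s).
Proof.
have de : is_cderive (fun t => (expR t)%:C) s (expR s)%:C.
  exact: (is_cderive_real (is_derive_expR s)).
have dt (i : nat) : is_cderive (fun t => c i * (lam i)%:C ^+ j.+1 / den i t) s
    (- (c i * (lam i)%:C ^+ j.+1 * ((expR s)%:C / den i s ^+ 2))).
  have dd := is_cderiveD de (is_cderive_cst (lam i)%:C s).
  apply: is_cderive_eq (is_cderiveZ (c i * (lam i)%:C ^+ j.+1) (is_cderiveV (den_neq0 i s) dd)) _.
  by rewrite /den; ring.
have ds : is_cderive (Qsum j) s (\sum_(i < N.+1)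
    - (c i * (lam i)%:C ^+ j.+1 * ((expR s)%:C / den i s ^+ 2))).
  rewrite /Qsum; elim: (index_enum _) => [|i r ih].
    rewrite big_nil; apply: is_cderive_ext (is_cderive_cst 0 s) => t.
    by rewrite big_nil.
  rewrite big_cons; apply: is_cderive_ext (is_cderiveD (dt i) ih) => t.
  by rewrite big_cons.
apply: is_cderive_eq (is_cderiveM (is_cderive_ce w s) ds) _.
rewrite mulrA; congr (_ + _).
rewrite mulr_sumr -sumrN; apply: eq_bigr => i _.
by rewrite /Tterm ceD ce1; ring.
Qed.

(** * Mellin transform of [Qsum] for [0 <= Re w < 1] *)

Section strip.
Variables (j : nat) (w : R[i]).
Hypothesis jN : (2 * j < N)%N.
Hypothesis w01 : 0 <= Re w < 1.
Hypothesis wj : 0 < Re w \/ (0 < j)%N.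

(** At plus infinity [Qsum j] is of order [exp (- s)]. At minus infinity it is bounded, which
    suffices for [Re w > 0]; on the line [Re w = 0] the decay comes from
    [Qsum j = - exp s * Qsum (j - 1)], hence the alternative [0 < j]. *)
Lemma expdec_Qsum : expdec (fun s => ce w s * Qsum j s).
Proof.
case/andP: w01 => w0 w1.
have [A hA] := Qsum_bound_y j.
have hy s : normc (ce w s * Qsum j s) <= A * expR (- ((1 - Re w) * s)).
  rewrite ComplexField.Normc.normcM normc_ce.
  apply: (@le_trans _ _ (expR (Re w * s) * (A * expR (- s)))).
    by rewrite ler_wpM2l ?expR_ge0.
  rewrite mulrCA -expRD; have -> : Re w * s - s = - ((1 - Re w) * s) by ring.
  exact: lexx.
case: wj => [w_gt0|j_gt0].
- have [B hB] := Qsum_bound j.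
  apply: (@expdecI _ _ B A (Re w) (1 - Re w)) => //; first by rewrite subr_gt0.
  by move=> s; rewrite ComplexField.Normc.normcM normc_ce mulrC ler_wpM2r ?expR_ge0.
- move: jN j_gt0 hy; case: j => // k kN _ hy.
  have [B hB] := Qsum_bound k.
  apply: (@expdecI _ _ B A (Re w + 1) (1 - Re w)) => //; rewrite ?subr_gt0 ?ltr_wpDl //.
  move=> s; have -> : Qsum k.+1 s = - ((expR s)%:C * Qsum k s) by rewrite QsumS // opprK.
  rewrite mulrN normcN !ComplexField.Normc.normcM normc_ce normc_real ger0_norm ?expR_ge0 //.
  rewrite mulrA -expRD mulrDl mul1r mulrC ler_wpM2r ?expR_ge0 //.
Qed.

Lemma cintegrable_Qsum : cintegrable setT (fun s => ce w s * Qsum j s).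
Proof.
apply: cintegrable_expdec expdec_Qsum.
by apply: ccontinuousM; [exact: ccontinuous_ce|exact: ccontinuous_Qsum].
Qed.

Lemma strip_sub : -1 < Re w < 1.
Proof. by case/andP: w01 => w0 ->; rewrite andbT (lt_le_trans _ w0). Qed.

Lemma ccontinuous_Tterm i : ccontinuous (Tterm j w i).
Proof.
apply: ccontinuousM; first exact: ccontinuous_cst.
apply: ccontinuousM; first exact: ccontinuous_ce.
apply: ccontinuousV; first by move=> s; rewrite expf_neq0 // den_neq0.
exact/ccontinuousX/ccontinuous_den.
Qed.

Lemma Tterm0 i s : lam i = 0 -> Tterm j w i s = 0.
Proof. by move=> e; rewrite /Tterm e exprS mul0r mulr0 mul0r. Qed.

Lemma cintegrable_Tterm i : cintegrable setT (Tterm j w i).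
Proof.
case/andP: w01 => w0 w1.
have [e|l0] := eqVneq (lam i) 0.
  have -> : Tterm j w i = fun=> 0 by apply/funext => s; rewrite Tterm0.
  exact: cintegrable0.
have lp : 0 < lam i by rewrite lt_def l0 lam_ge0.
apply: cintegrable_expdec; first exact: ccontinuous_Tterm.
pose B := normc (c i * (lam i)%:C ^+ j.+1).
have TE s : normc (Tterm j w i s) = B * (expR ((Re w + 1) * s) / (expR s + lam i) ^+ 2).
  rewrite /Tterm /B !ComplexField.Normc.normcM ComplexField.Normc.normcV !normcX.
  by rewrite normc_den normc_ce (Re_addn w 1).
apply: (@expdecI _ _ (B / lam i ^+ 2) B (Re w + 1) (1 - Re w)).
- by rewrite ltr_wpDl.
- by rewrite subr_gt0.
- move=> s; rewrite TE -mulrA ler_wpM2l ?normc_ge0 // mulrC ler_wpM2r ?expR_ge0 //.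
  have h : lam i ^+ 2 <= (expR s + lam i) ^+ 2.
    by rewrite lerXn2r ?nnegrE ?(ltW (den_gt0 _ _)) // lerDr expR_ge0.
  have p1 : 0 < lam i ^+ 2 by exact: exprn_gt0.
  by rewrite lef_pV2 // posrE //; exact: lt_le_trans h.
- move=> s; rewrite TE ler_wpM2l ?normc_ge0 // ler_pdivrMr ?exprn_gt0 //.
  apply: (@le_trans _ _ (expR (- ((1 - Re w) * s)) * expR s ^+ 2)).
    rewrite -expRM_natl -expRD ler_expR; lra.
  rewrite ler_wpM2l ?expR_ge0 // lerXn2r ?nnegrE ?expR_ge0 ?(ltW (den_gt0 _ _)) //.
  by rewrite lerDl.
Qed.

(** Translating [s] by [ln (lam i)] scales [lam i] out, with total exponent
    [(j + 1) + (w + 1) - 2 = w + j]. The conditional isolates [lam i = 0], where [ln] has a default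
    value. *)
Lemma cintegral_Tterm i :
  cintegral setT (Tterm j w i) =
  betaK w * (c i * if lam i == 0 then 0 else ce (w + j%:R) (ln (lam i))).
Proof.
have [e|l0] := eqVneq (lam i) 0.
  have -> : Tterm j w i = fun=> 0 by apply/funext => s; rewrite Tterm0.
  by rewrite cintegral0 !mulr0.
have lp : 0 < lam i by rewrite lt_def l0 lam_ge0.
have lc0 : (lam i)%:C != 0 :> R[i] by exact: real_gt0_neq0.
have TE t : Tterm j w i (ln (lam i) + 1 * t) =
    c i * ce (w + j%:R) (ln (lam i)) * (ce (w + 1) t / (1 + (expR t)%:C) ^+ 2).
  have le : ce 1 (ln (lam i)) = (lam i)%:C by rewrite ce1 lnK.
  rewrite /Tterm /den mul1r ce_addt expRD lnK // realcM.
  have -> : ce (w + 1) (ln (lam i)) = ce w (ln (lam i)) * (lam i)%:C by rewrite ceD le.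
  have -> : ce (w + j%:R) (ln (lam i)) = ce w (ln (lam i)) * (lam i)%:C ^+ j.
    by rewrite ceD ce_nat lnK.
  have n1 := onePexp_neq0 t.
  have -> : (lam i)%:C * (expR t)%:C + (lam i)%:C = (lam i)%:C * (1 + (expR t)%:C) :> R[i] by ring.
  rewrite exprS; move: ((lam i)%:C ^+ j) (ce w _) => x y.
  by field; rewrite n1 lc0.
have iT : cintegrable setT (fun t => Tterm j w i (ln (lam i) + 1 * t)).
  have := cintegrableZ (c i * ce (w + j%:R) (ln (lam i))) (cintegrable_betaK strip_sub).
  by apply: eq_cintegrable => t; rewrite TE.
rewrite (cintegral_affine ltr01 (ccontinuous_Tterm i) iT).2 mul1r.
rewrite (eq_cintegral (G := fun t => c i * ce (w + j%:R) (ln (lam i)) *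
  (ce (w + 1) t / (1 + (expR t)%:C) ^+ 2))) => [|t _]; last exact: TE.
rewrite cintegralZ; last exact: cintegrable_betaK strip_sub.
by rewrite -/(betaK w) mulrC.
Qed.

(** Integration by parts; the factor [w] stays on the left because it may be 0. *)
Lemma cintegral_Qsum :
  w * cintegral setT (fun s => ce w s * Qsum j s) =
  betaK w * \sum_(i < N.+1) c i * if lam i == 0 then 0 else ce (w + j%:R) (ln (lam i)).
Proof.
have iQ := cintegrable_Qsum.
have iT : cintegrable setT (fun s => \sum_(i < N.+1) Tterm j w i s).
  by apply: cintegrable_sum => i; exact: cintegrable_Tterm.
have h : cintegral setT (fun s => w * (ce w s * Qsum j s) - \sum_(i < N.+1) Tterm j w i s) = 0.
  apply: (@cintegral_derive _ (fun s => ce w s * Qsum j s)).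
  - by move=> s; exact: is_cderive_Qsum.
  - apply: ccontinuousB.
      apply: ccontinuousM; first exact: ccontinuous_cst.
      by apply: ccontinuousM; [exact: ccontinuous_ce|exact: ccontinuous_Qsum].
    by apply: ccontinuous_sum => i _; exact: ccontinuous_Tterm.
  - by apply: cintegrableD; [exact: cintegrableZ|exact: cintegrableN].
  - exact: expdec_Qsum.
move: h; rewrite cintegralB //; last exact: cintegrableZ.
rewrite cintegralZ // => /eqP; rewrite subr_eq0 => /eqP ->.
rewrite cintegral_sum => [|i]; last exact: cintegrable_Tterm.
by rewrite mulr_sumr; apply: eq_bigr => i _; exact: cintegral_Tterm.
Qed.

End strip.

End MellinTransform.

(** * The ratio of Gamma factors *)

Section GammaRatio.
Context {R : realType}.
Implicit Types (z w p : R[i]) (t s u : R).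

Lemma csin_addn z (j : nat) : csin (pi%:C * (z + j%:R)) = (-1) ^+ j * csin (pi%:C * z).
Proof.
elim: j => [|j ih]; first by rewrite addr0 expr0 mul1r.
have -> : pi%:C * (z + j.+1%:R) = pi%:C * (z + j%:R) + pi%:C by rewrite -natr1; ring.
by rewrite csinDpi ih exprS mulN1r mulNr.
Qed.

Lemma csin_i u : csin (pi%:C * ('i%C * u%:C)) = 'i%C * (sinh (pi * u))%:C.
Proof.
have i2 := @sqr_i R.
have e : 'i%C * (pi%:C * ('i%C * u%:C)) = (- (pi * u))%:C :> R[i].
  rewrite realcN realcM; transitivity ('i%C ^+ 2 * (pi%:C * u%:C)); first by ring.
  by rewrite i2 mulN1r.
rewrite /csin e -realcN opprK !cexp_real /sinh realcM realcV natc realcD realcN.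
by rewrite invfM invi; ring.
Qed.

Lemma sinh_gt0 u : 0 < u -> 0 < sinh u.
Proof.
move=> u0; rewrite /sinh divr_gt0 ?ltr0n // subr_gt0 ltr_expR.
by rewrite (lt_trans _ u0) // oppr_lt0.
Qed.

Lemma Gamma_sinh u : 0 < u ->
  Gamma (1 + 'i%C * u%:C) * Gamma (1 - 'i%C * u%:C) * (sinh (pi * u))%:C = (pi * u)%:C.
Proof.
move=> u0.
have r0 : Re ('i%C * u%:C : R[i]) = 0 by rewrite ReM /= mul0r mulr0 subr0.
have r11 : -1 < Re ('i%C * u%:C : R[i]) < 1 by rewrite r0 ltrN10 ltr01.
rewrite Gamma_reflection //; apply: (mulfI i_neq0).
have := betaK_reflection r11; rewrite csin_i realcM => h.
by rewrite mulrCA h; ring.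
Qed.

Lemma coef_real (n N i : nat) : coef n N i = ((-1) ^+ n * ((-1) ^+ i * 'C(N, i)%:R))%:C :> R[i].
Proof. by rewrite /coef !realcM !realcX !realcN natc. Qed.

Lemma Re_mulr_real t z : Re (t%:C * z) = t * Re z.
Proof. by rewrite ReM /= mul0r subr0. Qed.

Section ratio.
Variables (n a : nat) (u : R).
Hypothesis u0 : 0 < u.
Local Notation N := (n + a)%N.
Local Notation y := ('i%C * u%:C : R[i]).

Let ImyE (k : nat) : Im (y - n%:R + k%:R) = u.
Proof. by rewrite !ReImE /=; ring. Qed.

Let yk_neq0 (k : nat) : y - n%:R + k%:R != 0.
Proof.
apply/eqP => e; have := ImyE k; rewrite e /= => h; by move: u0; rewrite -h ltxx.
Qed.

(** This is [altsum_inv] at [z = y - n], with the factor [y] of the product moved to the numerators.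
    No denominator vanishes, since each has imaginary part [u > 0]. *)
Lemma partial_fractions :
  N`!%:R / (\prod_(k < a) (k.+1%:R + y) * \prod_(k < n) (k.+1%:R - y)) =
  \sum_(i < N.+1) coef n N i * (y / (y - n%:R + i%:R)).
Proof.
have h := altsum_inv (fun i _ => yk_neq0 i) (N := N).
have f0 : N`!%:R != 0 :> R[i] by rewrite pnatr_eq0 -lt0n fact_gt0.
have p1 : \prod_(k < n) (k.+1%:R - y) != 0.
  by apply/eqP => e; move: f0; rewrite -h prod_shift e !(mulr0, mul0r) eqxx.
have p2 : \prod_(k < a) (k.+1%:R + y) != 0.
  by apply/eqP => e; move: f0; rewrite -h prod_shift e !(mulr0, mul0r) eqxx.
rewrite -h prod_shift.
have -> : \sum_(i < N.+1) coef n N i * (y / (y - n%:R + i%:R)) =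
    (-1) ^+ n * y * altsum N (fun i => (y - n%:R + i%:R)^-1).
  rewrite /altsum mulr_sumr; apply: eq_bigr => i _; rewrite /coef; ring.
move: (altsum _ _) (\prod_(k < a) _) (\prod_(k < n) _) p1 p2 => A B D p1 p2.
by field; rewrite p1 p2.
Qed.

Lemma Re_fraction (i : nat) :
  Re (y / (y - n%:R + i%:R)) = u ^+ 2 / (u ^+ 2 + lam n i).
Proof.
have rE : Re (y - n%:R + i%:R) = - (n%:R - i%:R) by rewrite !ReImE /=; ring.
rewrite ReM ReV ImV rE ImyE.
have -> : Re y = 0 by rewrite !ReImE /=; ring.
have -> : Im y = u by rewrite !ReImE /=; ring.
by rewrite /lam sqrrN [_ ^+ 2 + u ^+ 2]addrC; ring.
Qed.

(** The product [Gamma (1 + y) * Gamma (1 - y)] is the real number [pi u / sinh (pi u)] and leaves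
    the real part; ['C(N, n) a! n! = N!] then gives the numerator of the partial fractions. *)
Lemma Re_Gamma_ratio :
  'C(N, n)%:R * (Re (Gamma (a%:R + 1) * Gamma (n%:R + 1)
    / (Gamma (a%:R + y + 1) * Gamma (n%:R - y + 1))))%:C =
  (sinh (pi * u) / (pi * u))%:C *
  \sum_(i < N.+1) coef n N i * (u ^+ 2 / (u ^+ 2 + lam n i))%:C.
Proof.
have pu0 : 0 < pi * u by rewrite mulr_gt0 // pi_gt0.
have s0 := sinh_gt0 pu0.
have ry : Re y = 0 by rewrite !ReImE /=; ring.
have y1 : -1 < Re y by rewrite ry ltrN10.
have Ny1 : -1 < Re (- y) by rewrite ReN ry oppr0 ltrN10.
rewrite (Gamma_addn a y1) (Gamma_addn n Ny1) !Gamma_nat.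
have hs := Gamma_sinh u0.
have sc0 : (sinh (pi * u))%:C != 0 :> R[i] by exact: real_gt0_neq0.
have puc0 : (pi * u)%:C != 0 :> R[i] by exact: real_gt0_neq0.
set g := a`!%:R * n`!%:R / _.
have gE : g = (sinh (pi * u) / (pi * u))%:C *
    (a`!%:R * n`!%:R / (\prod_(k < a) (k.+1%:R + y) * \prod_(k < n) (k.+1%:R - y))).
  rewrite /g.
  have -> : \prod_(k < a) (k.+1%:R + y) * Gamma (1 + y) *
      (\prod_(k < n) (k.+1%:R + - y) * Gamma (1 - y)) =
     (\prod_(k < a) (k.+1%:R + y) * \prod_(k < n) (k.+1%:R - y)) *
     (Gamma (1 + y) * Gamma (1 - y)) by ring.
  have -> : Gamma (1 + y) * Gamma (1 - y) = (pi * u / sinh (pi * u))%:C.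
    by apply: (mulIf sc0); rewrite hs [in RHS]realcM realcV mulfVK.
  by rewrite invfM -realcV invf_div; ring.
set X : R[i] := _ / (_ * _) in gE.
have -> : (Re g)%:C = (sinh (pi * u) / (pi * u))%:C * (Re X)%:C :> R[i].
  by rewrite gE Re_mulr_real [LHS]realcM.
rewrite mulrCA; congr (_ * _); rewrite /X.
rewrite -natc -realcM -Re_mulr_real natc.
have -> : 'C(N, n)%:R * (a`!%:R * n`!%:R /
    (\prod_(k < a) (k.+1%:R + y) * \prod_(k < n) (k.+1%:R - y))) =
    N`!%:R / (\prod_(k < a) (k.+1%:R + y) * \prod_(k < n) (k.+1%:R - y)).
  rewrite mulrA; congr (_ / _); rewrite -!natrM; congr (_%:R).
  by rewrite -(@bin_fact N n) ?leq_addr // addKn [(n`! * _)%N]mulnC.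
rewrite partial_fractions Re_sum.
rewrite (big_morph (real_complex R) realcD (erefl _)); apply: eq_bigr => i _.
by rewrite coef_real Re_mulr_real Re_fraction; exact: realcM.
Qed.

End ratio.
End GammaRatio.

(** * The central sum *)

Section CentralSum.
Context {R : realType}.
Implicit Types (z w p : R[i]) (t s u : R).

Lemma signz (n i : nat) : (-1) ^ (n%:Z - i%:Z) = (-1) ^+ n * (-1) ^+ i :> R[i].
Proof.
have u1 : (-1 : R[i]) \is a GRing.unit by rewrite unitrN1.
by rewrite exprzDr // -invr_expz -!exprnP -exprVn invrN1.
Qed.

(** For [i = n] both sides are 0; this is where [p != 0] enters, because [cpow] has [0 ^ 0 = 1]. *)
Lemma ce_lam p (n i : nat) : p != 0 ->
  (if lam n i == 0 :> R then 0 else ce (p / 2%:R) (ln (lam n i))) =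
  cpow (`|n%:R - i%:R| : R)%:C p.
Proof.
move=> p0; have [e|l0] := eqVneq (lam n i : R) 0.
  have -> : `|n%:R - i%:R| = 0 :> R by apply/eqP; rewrite normr_eq0 -sqrf_eq0 -/(lam n i) e.
  by rewrite /cpow eqxx (negbTE p0).
have l1 : 0 < `|n%:R - i%:R| :> R by rewrite normr_gt0 -sqrf_eq0.
have -> : ln (lam n i) = 2 * ln `|n%:R - i%:R| :> R.
  by rewrite /lam -[_ ^+ 2]ger0_norm ?sqr_ge0 // normrX lnXn // mulr_natl.
rewrite cpow_pos //.
by rewrite /ce realcM natc; congr cexp; field.
Qed.

Definition mellin_integrand (n a : nat) p u : R[i] :=
  cpow u%:C p / (sinh (pi * u))%:C
    * (Re (Gamma (a%:R + 1) * Gamma (n%:R + 1)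
        / (Gamma (a%:R + 'i%C * u%:C + 1) * Gamma (n%:R - 'i%C * u%:C + 1))))%:C.

(** * Evaluation for a fixed exponent, with [a = n - m] and [N = 2 n - m] *)

Section sum.
Variables (n a : nat) (p : R[i]).
Hypothesis n_gt0 : (0 < n)%N.
Let N := (n + a)%N.
Hypothesis hp : 1 <= Re p < (n + a)%:R.

Let N_gt0 : (0 < N)%N. Proof. by rewrite addn_gt0 n_gt0. Qed.

Let z := p / 2%:R.
(** The integer part of [Re p / 2] brings [w] into the strip, while [2 j <= Re p < N] stays in the
    range of vanishing moments. *)
Let j := Num.truncn (Re z).
Let w := z - j%:R.

Let ReE : Re z = Re p / 2.
Proof. by rewrite /z -natc -realcV ReM /= mulr0 subr0. Qed.

Let jz : j%:R <= Re z < j.+1%:R.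
Proof.
apply: truncn_itv; rewrite ReE; case/andP: hp => h _.
by rewrite divr_ge0 // (le_trans _ h).
Qed.

Let ReW : Re w = Re z - j%:R.
Proof. by rewrite /w ReD ReN Re_nat. Qed.

Let w01 : 0 <= Re w < 1.
Proof.
by rewrite ReW subr_ge0 ltrBlDl natr1; exact: jz.
Qed.

Let jN : (2 * j < N)%N.
Proof.
rewrite -(ltr_nat R) natrM; case/andP: hp => _; apply: le_lt_trans.
by case/andP: jz => h _; rewrite ReE ler_pdivlMr // in h; rewrite mulrC.
Qed.

Let wj : 0 < Re w \/ (0 < j)%N.
Proof.
have [j0|j0] := posnP j; last by right.
left; rewrite ReW j0 subr0 ReE divr_gt0 //; case/andP: hp => h _.
exact: lt_le_trans h.
Qed.

Let p_neq0 : p != 0.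
Proof.
apply/eqP => e; case/andP: hp => h _; move: h; rewrite e /= ler10.
by [].
Qed.

Let L : R[i] := \sum_(i < N.+1) coef n N i * cpow (`|n%:R - i%:R| : R)%:C p.

(** The integrand in the variable [s = 2 ln x], up to a constant factor. *)
Let H s : R[i] := ce z s * - Qsum n N 0 s.

Let HE s : H s = - (-1) ^+ j * (ce w s * Qsum n N j s).
Proof.
rewrite /H mulNr mulrN; congr (- _).
have -> : z = w + j%:R by rewrite /w subrK.
by rewrite ceD ce_nat -mulrA (Qsum_expR n s jN); ring.
Qed.

Let iH : cintegrable setT H.
Proof.
apply: eq_cintegrable (cintegrableZ (- (-1) ^+ j) (cintegrable_Qsum n jN w01 wj)) => s.
by rewrite HE.
Qed.

Let cH : ccontinuous H.
Proof.
apply: ccontinuousM; first exact: ccontinuous_ce.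
exact/ccontinuousN/ccontinuous_Qsum.
Qed.

(** Two signs [(-1) ^ j] cancel, one from shifting the sine and one from reducing [Qsum 0] to
    [Qsum j]; the reflection formula does the rest. *)
Let csin_cintegral_H : csin (pi%:C * z) * cintegral setT H = - pi%:C * L.
Proof.
have -> : cintegral setT H = - (-1) ^+ j * cintegral setT (fun s => ce w s * Qsum n N j s).
  rewrite -cintegralZ; last exact: cintegrable_Qsum.
  by apply: eq_cintegral => s _; exact: HE.
have zE : z = w + j%:R by rewrite /w subrK.
have -> : csin (pi%:C * z) = (-1) ^+ j * csin (pi%:C * w) by rewrite {1}zE csin_addn.
have sgn : (-1) ^+ j * (-1) ^+ j = 1 :> R[i] by rewrite -exprMn mulrNN mulr1 expr1n.
set I := cintegral _ _.
have -> : (-1) ^+ j * csin (pi%:C * w) * (- (-1) ^+ j * I) = - (csin (pi%:C * w) * I).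
  transitivity (- ((-1) ^+ j * (-1) ^+ j * (csin (pi%:C * w) * I))); first by ring.
  by rewrite sgn mul1r.
have hI : w * I = betaK w * L.
  rewrite /I (cintegral_Qsum n jN w01 wj); congr (_ * _); apply: eq_bigr => i _.
  by rewrite -zE /z ce_lam.
have [w0|w0] := eqVneq w 0; last first.
  have := betaK_reflection (strip_sub w01) => hb.
  apply: (mulfI w0); rewrite mulrN mulrCA hI mulrCA mulrA hb; ring.
(* Here [p = 2 j] with [j > 0]: the sine is 0 and [L] is the moment of order [j]. *)
rewrite w0 mulr0 (_ : csin 0 = 0); last by rewrite /csin mulr0 oppr0 subrr mul0r.
have j0 : (0 < j)%N by case: wj => //; rewrite w0 /= ltxx.
have -> : L = \sum_(i < N.+1) coef n N i * (lam n i)%:C ^+ j.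
  apply: eq_bigr => i _; congr (_ * _); rewrite -ce_lam // -/z zE w0 add0r ce_nat.
  have [->|l0] := eqVneq (lam n i : R) 0; first by rewrite expr0n eqn0Ngt j0.
  by rewrite lnK // posrE lt_def l0 lam_ge0.
by rewrite (moment_eq0 n jN) mulr0 mul0r oppr0.
Qed.

Let kappa : R[i] := ('C(N, n)%:R * pi%:C)^-1.

Let f := mellin_integrand n a p.

(** The integrand as a function of [t = ln x]; the added 0 matches the form of
    [cintegral_affine]. *)
Let G t : R[i] := kappa * (H (0 + 2 * t) / (expR t)%:C).

Let C_neq0 : 'C(N, n)%:R != 0 :> R[i].
Proof. by rewrite pnatr_eq0 -lt0n bin_gt0 leq_addr. Qed.

Let pi_neq0 : pi%:C != 0 :> R[i].
Proof. by apply: real_gt0_neq0; exact: pi_gt0. Qed.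

Let fG u : 0 < u -> f u = G (ln u).
Proof.
move=> u0; apply: (mulfI C_neq0).
have pu0 : 0 < pi * u by rewrite mulr_gt0 // pi_gt0.
have sc0 : (sinh (pi * u))%:C != 0 :> R[i] by apply: real_gt0_neq0; exact: sinh_gt0.
have uc0 : u%:C != 0 :> R[i] by exact: real_gt0_neq0.
rewrite /f /mellin_integrand mulrCA (Re_Gamma_ratio n a u0) cpow_pos //.
have sE : \sum_(i < N.+1) coef n N i * (u ^+ 2 / (u ^+ 2 + lam n i))%:C =
    - Qsum n N 0 (2 * ln u).
  rewrite -(sum_Qsum0 n N_gt0); apply: eq_bigr => i _; congr (_ * _).
  by rewrite /den expRM_natl lnK // realcM realcV realcD.
rewrite sE /G /H add0r lnK // /kappa.
have -> : ce z (2 * ln u) = ce p (ln u).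
  by rewrite /ce /z realcM natc; congr cexp; field.
rewrite [in LHS]realcM [in LHS]realcV [in LHS]realcM.
move: (ce p _) (Qsum _ _ _ _) => x y.
move: C_neq0 pi_neq0 uc0 sc0.
move: ('C(N, n)%:R : R[i]) (pi%:C : R[i]) (u%:C : R[i]) ((sinh _)%:C : R[i]).
by move=> b q v r b0 q0 v0 r0; field; rewrite b0 q0 v0 r0.
Qed.

Let cintegral_f :
  cintegrable `]0, +oo[ f /\
  cintegral `]0, +oo[ f = kappa * (2%:R^-1 * cintegral setT H).
Proof.
have GE t : G t * (expR t)%:C = kappa * H (0 + 2 * t).
  by rewrite /G -mulrA divfK // real_gt0_neq0 // expR_gt0.
have c2 : continuous (fun t : R => 0 + 2 * t).
  move=> t; apply: cvgD; first exact: cvg_cst.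
  by apply: cvgM; [exact: cvg_cst|exact: cvg_id].
have cH2 : ccontinuous (fun t => H (0 + 2 * t)) by exact: ccontinuous_comp.
(* The rescaling is applied to [H (2 t)] with factor [1 / 2], because integrability is known for
   [H]. *)
have half s : 0 + 2 * (0 + 2^-1 * s) = s :> R by rewrite !add0r mulrA mulfV ?mul1r.
have i2 : cintegrable setT (fun s => H (0 + 2 * (0 + 2^-1 * s))).
  by apply: eq_cintegrable iH => s; rewrite half.
have h2 : 0 < 2^-1 :> R by rewrite invr_gt0 ltr0n.
have [jH eH] := cintegral_affine h2 cH2 i2.
have iG : cintegrable setT (fun t => G t * (expR t)%:C).
  by apply: eq_cintegrable (cintegrableZ kappa jH) => t; rewrite GE.
have cG : ccontinuous G.
  apply: ccontinuousM; first exact: ccontinuous_cst.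
  apply: ccontinuousM => //; apply: ccontinuousV.
    by move=> t; apply: real_gt0_neq0; exact: expR_gt0.
  by apply: ccontinuous_real; exact: continuous_expR.
have [if_ ef] := cintegral_ln cG fG iG.
split => //; rewrite ef.
rewrite (eq_cintegral (G := fun t => kappa * H (0 + 2 * t))) => [|t _]; last exact: GE.
have -> : cintegral setT H = cintegral setT (fun s => H (0 + 2 * (0 + 2^-1 * s))).
  by apply: eq_cintegral => s _; rewrite half.
rewrite cintegralZ; last exact: jH.
by rewrite eH realcV natc.
Qed.

Lemma central_sum :
  cintegrable `]0, +oo[ (mellin_integrand n a p) /\
  \sum_(i < (n + a).+1) coef n (n + a) i * cpow (`|n%:R - i%:R| : R)%:C p =
  - 2%:R * csin (pi%:C * p / 2%:R) * 'C(n + a, n)%:R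
    * cintegral `]0, +oo[ (mellin_integrand n a p).
Proof.
have [if_ ef] := cintegral_f; split => //; rewrite -/f ef -/N -/L; have := csin_cintegral_H.
have -> : pi%:C * p / 2%:R = pi%:C * z by rewrite /z mulrA.
move=> h; apply: (mulfI pi_neq0).
transitivity (- (- pi%:C * L)); first by ring.
rewrite -h /kappa; move: (csin _) (cintegral _ _) => x y.
move: C_neq0 pi_neq0; move: ('C(N, n)%:R : R[i]) (pi%:C : R[i]).
by move=> b q b0 q0; field; rewrite b0 q0.
Qed.

End sum.
End CentralSum.

Theorem theorem7p1 (R : realType) (n m : nat) (p : R[i])
    (hn : (1 <= n)%N) (hm : (m <= n)%N)
    (hp : 1 <= complex.Re p < (2 * n - m)%:R) :
  let f : R -> R[i] := fun x =>
    cpow x%:C p / (sinh (pi * x))%:C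
    * (complex.Re (Gamma ((n - m)%:R + 1) * Gamma (n%:R + 1)
        / (Gamma ((n - m)%:R + 'i%C * x%:C + 1)
           * Gamma (n%:R - 'i%C * x%:C + 1))))%:C in
  cintegrable `]0, +oo[ f /\
  \sum_(0 <= i < (2 * n - m).+1)
     (-1) ^ (n%:Z - i%:Z) * 'C(2 * n - m, i)%:R
     * cpow (`|n%:R - i%:R| : R)%:C p
  = - 2%:R * csin (pi%:C * p / 2%:R) * 'C(2 * n - m, n)%:R
     * cintegral `]0, +oo[ f.
Proof.
(* The truncated subtraction is harmless by [m <= n]. *)
move: hp; have -> : (2 * n - m)%N = (n + (n - m))%N by rewrite mul2n -addnn addnBA.
move=> hp f; have [if_ <-] := central_sum hn hp; split => //.
rewrite big_mkord; apply: eq_bigr => i _.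
by rewrite signz /coef !mulrA.
Qed.
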